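(* Let $\mathbf{X}\in\mathbb{R}^{n\times p}$ be deterministic, $\beta^*\in\mathbb{R}^p$, $s=|\beta^*|_0\ge1$, and $y=\mathbf{X}\beta^*+\varepsilon$, where $\varepsilon$ has distribution $N(0,\sigma^2I_{n\times n})$ with $\sigma>0$. Let $h(\beta)=\sqrt n\,\lambda\|\beta\|_1$ and $\hat\beta\in\operatorname*{argmin}_{\beta\in\mathbb{R}^p}\|\mathbf{X}\beta-y\|^2+2h(\beta)$. Let $\gamma>0$ and define $$\underline C=\frac{1}{1+\delta_s},\qquad c_0=\frac{1+\gamma+\sqrt3}{\gamma},\qquad \bar C=\frac{1}{\kappa(c_0,s)}\left(1+\frac{\sigma\,\kappa(c_0,s)\,(\sqrt s+2\sqrt{\log 3})}{\lambda\sqrt s}+\frac{\sqrt3}{\sqrt{\log(9ep/s)}}\right).$$ If the tuning parameter $\lambda$ satisfies $$\lambda\ \ge\ \sigma(1+\gamma)(1+\delta_s)\big(1+\sqrt{2\log(9ep/s)}\big),$$ then with probability at least $0.76$ $$\|\mathbf{X}(\hat\beta-\beta^* )\|\ \le\ \bar C\,\lambda\sqrt s.$$ Furthermore, if in addition $\bar C\le2\underline C$ and the components of $\beta^*$ satisfy $$\min_{j:\ \beta^*_j\ne0}|\beta^*_j|\ \ge\ \frac{(2\underline C-\bar C)\,\underline C\,\lambda}{\sqrt n},$$ then with probability at least $0.26$ $$\|\mathbf{X}(\hat\beta-\beta^* )\|\ \ge\ \lambda\sqrt s\;\underline C\left(1-\sqrt{\bar C/\underline C-1}\right).$$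
   Context: $\|\cdot\|$ is the Euclidean norm, $\|\cdot\|_1$ the $\ell_1$-norm, $|\beta|_0$ the number of nonzero components of $\beta$, and $e$ is Euler's number. For $s\in\{1,\dots,p\}$, $\delta_s\ge0$ is the smallest $\delta\ge0$ such that $$(1-\delta)\|\beta\|\le\tfrac1{\sqrt n}\|\mathbf{X}\beta\|\le(1+\delta)\|\beta\|\qquad\text{for all }\beta\in\mathbb{R}^p\text{ with }|\beta|_0\le s.$$ For $c_0>0$, the Restricted Eigenvalue constant is $$\kappa(c_0,s)=\inf_{\alpha\in\mathbb{R}^p\setminus\{0\}:\ \sum_{j=s+1}^p\alpha_j^\sharp\le c_0\sqrt s\,\|\alpha\|}\frac{\|\mathbf{X}\alpha\|}{\sqrt n\,\|\alpha\|},$$ where $\alpha_1^\sharp\ge\dots\ge\alpha_p^\sharp$ is the nonincreasing rearrangement of $(|\alpha_1|,\dots,|\alpha_p|)$. If $\kappa(c_0,s)=0$, $\bar C$ is understood as $+\infty$. *)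

(* Defs.v *)
From HB Require Import structures.
From mathcomp Require Import all_boot all_order all_algebra.
From mathcomp Require Import all_classical all_reals all_analysis.
Set Implicit Arguments.
Unset Strict Implicit.
Unset Printing Implicit Defensive.
Import Order.TTheory GRing.Theory Num.Theory.

Local Open Scope classical_set_scope.
Local Open Scope ring_scope.

(* The canonical norm `|v| on matrices is the sup norm, hence l2norm. *)
Definition l2norm (R : realType) (m : nat) (v : 'cV[R]_m) : R :=
  Num.sqrt (\sum_(i < m) v i 0 ^+ 2).

Definition l1norm (R : realType) (m : nat) (v : 'cV[R]_m) : R :=
  \sum_(i < m) `|v i 0|.

Definition l0norm (R : realType) (m : nat) (v : 'cV[R]_m) : nat :=
  #|[pred i : 'I_m | v i 0 != 0]|.

Definition argmin (T : Type) (R : realType) (f : T -> R) : set T :=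
  [set x | forall y, f x <= f y].

(* The set below is closed, bounded below, and nonempty when 0 < n, so its
   infimum is its smallest element. *)
Definition delta (R : realType) (n p : nat) (X : 'M[R]_(n, p)) (s : nat) : R :=
  inf [set d | 0 <= d /\ forall b : 'cV[R]_p, (l0norm b <= s)%N ->
    (1 - d) * l2norm b <= (Num.sqrt n%:R)^-1 * l2norm (X *m b)
      <= (1 + d) * l2norm b].

(* The entries |v_j| in nonincreasing order; the list is indexed from 0, so
   v_j^sharp is its entry of index j - 1. *)
Definition rearrangement (R : realType) (m : nat) (v : 'cV[R]_m) : seq R :=
  sort (fun x y : R => y <= x) [seq `|v i 0| | i <- enum 'I_m].

Definition RE_cone (R : realType) (p : nat) (c0 : R) (s : nat) :
    set 'cV[R]_p :=
  [set a | a != 0 /\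
    \sum_(s <= j < p) (rearrangement a)`_j <= c0 * Num.sqrt s%:R * l2norm a].

Definition kappa (R : realType) (n p : nat) (X : 'M[R]_(n, p))
    (c0 : R) (s : nat) : R :=
  inf [set l2norm (X *m a) / (Num.sqrt n%:R * l2norm a) | a in RE_cone c0 s].

Definition h (R : realType) (n p : nat) (lambda : R) (b : 'cV[R]_p) : R :=
  Num.sqrt n%:R * lambda * l1norm b.

Definition lasso_objective (R : realType) (n p : nat) (X : 'M[R]_(n, p))
    (lambda : R) (y : 'cV[R]_n) (b : 'cV[R]_p) : R :=
  l2norm (X *m b - y) ^+ 2 + 2 * h n lambda b.

Definition log_term (R : realType) (p s : nat) : R :=
  ln (9 * expR 1 * p%:R / s%:R).

Definition Clow (R : realType) (n p : nat) (X : 'M[R]_(n, p)) (s : nat) : R :=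
  1 / (1 + delta X s).

Definition cone_const (R : realType) (gamma : R) : R :=
  (1 + gamma + Num.sqrt 3) / gamma.

Definition Cbar (R : realType) (n p : nat) (X : 'M[R]_(n, p))
    (sigma lambda gamma : R) (s : nat) : \bar R :=
  let k := kappa X (cone_const gamma) s in
  if k == 0 then +oo%E else
  (1 / k * (1 + sigma * k * (Num.sqrt s%:R + 2 * Num.sqrt (ln 3)) /
                  (lambda * Num.sqrt s%:R)
              + Num.sqrt 3 / Num.sqrt (log_term R p s)))%:E.

(* eps has distribution N(0, sigma^2 I_n): its coordinates are N(0, sigma^2)
   and mutually independent.  The second argument of normal_prob is the
   standard deviation.  Taking A i = setT for some of the i gives the product
   rule for every subfamily. *)
Definition isotropic_gaussian (R : realType) (d : measure_display)
    (T : measurableType d) (P : probability T R) (n : nat) (sigma : R)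
    (eps : 'I_n -> {RV P >-> R}) : Prop :=
  (forall (i : 'I_n) (A : set R), measurable A ->
     distribution P (eps i) A = normal_prob 0 sigma A) /\
  (forall A : 'I_n -> set R, (forall i, measurable (A i)) ->
     P (\bigcap_(i in [set: 'I_n]) (eps i @^-1` A i)) =
     (\prod_(i < n) P (eps i @^-1` A i))%E).

Definition rv_vector (R : realType) (d : measure_display)
    (T : measurableType d) (P : probability T R) (n : nat)
    (eps : 'I_n -> {RV P >-> R}) (w : T) : 'cV[R]_n :=
  \col_i eps i w.

(* Main.v *)
(* Let f = X^T eps / sqrt n (score), tau = sigma (1 + delta_s) (noise_level),
   lambda0 = lambda / (1 + gamma) (threshold), T the support of betastar and
   u = betahat - betastar.  The upper bound holds on the event

     sum_(j in T) f_j^2 + sum_(j notin T) (|f_j| - lambda0)_+^2 <= 6 s tau^2,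

   whose complement has probability at most 0.24 by Markov's inequality: the
   f_j are Gaussian with variance at most tau^2, so the first sum has mean about
   s tau^2, and the second one is negligible since
   lambda0 >= tau (1 + sqrt (2 log (9 e p / s))).  On this event Cauchy-Schwarz
   gives <eps, X u> / sqrt n <= sqrt (6 s) tau |u| + lambda0 |u_{T^c}|_1, and
   the variational inequality of the Lasso at betastar puts u in the cone of
   kappa (c0, s) and yields
     |X u|^2 <= <eps, X u> + h (betastar) - h (betahat)
             <= Cbar lambda sqrt s |X u|.

   For the lower bound, intersect this event with {<eps, X w> <= 0} for
   w = sign (betastar), which has probability at least 1/2 by symmetry of eps,
   and use the variational inequality at betastar - t w with
   t = (2 Clow - Cbar) Clow lambda / sqrt n.  With a = |X u|,
   A = lambda sqrt s Clow and B = Cbar lambda sqrt s it reads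
   (a - A)^2 <= A (B - A). *)

Require Import Defs.
From HB Require Import structures.
From mathcomp Require Import all_boot all_order all_algebra.
From mathcomp Require Import all_classical all_reals all_analysis.
From mathcomp Require Import measurable_realfun ring lra.
Import Order.TTheory GRing.Theory Num.Theory.
Import numFieldNormedType.Exports.
Set Implicit Arguments.
Unset Strict Implicit.
Unset Printing Implicit Defensive.

Local Open Scope classical_set_scope.
Local Open Scope ring_scope.

(** * Independence and Gaussian linear forms *)

Section Independence.
Context (d : measure_display) (T : measurableType d) (R : realType).
Variable P : probability T R.
Local Open Scope ereal_scope.
Import HBNNSimple.

(** The hypothesis is the case of indicators; simple functions follow by linearity and general [g]
    by monotone convergence. The weight [W] is a Gaussian density in one use and a product of
    independent factors in the other. *)
Lemma ge0_integral_density d' (T' : measurableType d')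
    (mu : {measure set T -> \bar R}) (nu : {measure set T' -> \bar R})
    (X : T -> T') (W : T -> R) (g : T' -> R) :
  measurable_fun setT X ->
  measurable_fun setT W -> (forall w, (0 <= W w)%R) ->
  (forall A, measurable A -> \int[mu]_w (\1_A (X w) * W w)%:E = nu A) ->
  measurable_fun setT g -> (forall x, (0 <= g x)%R) ->
  \int[mu]_w (g (X w) * W w)%:E = \int[nu]_x (g x)%:E.
Proof.
move=> mX mW W0 HW mg g0.
have mg' : measurable_fun [set: T'] (fun x => (g x)%:E) by
  exact/measurable_EFinP.
pose f_ := nnsfun_approx measurableT mg'.
have mfX n : measurable_fun setT (fun w => f_ n (X w)).
  exact: (measurableT_comp (measurable_funPT (f_ n)) mX).
have cvf x : (f_ n x)%:E @[n --> \oo] --> (g x)%:E.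
  apply: (@cvg_nnsfun_approx _ _ _ _ measurableT (fun x => (g x)%:E) mg') => //
    y _.
  by rewrite lee_fin.
have step n : \int[mu]_w (f_ n (X w) * W w)%:E = \int[nu]_x (f_ n x)%:E.
  have m1 (r : R) : measurable_fun setT
      (fun w => (\1_(f_ n @^-1` [set r]) (X w) * W w)%:E).
    apply/measurable_EFinP; apply: measurable_funM => //.
    by apply: (measurableT_comp _ mX); exact: measurable_indic.
  transitivity (\int[mu]_w (\sum_(k \in range (f_ n))
      (k%:E * (\1_(f_ n @^-1` [set k]) (X w) * W w)%:E))).
    apply: eq_integral => w _.
    rewrite EFinM fimfunE -fsumEFin// ge0_mule_fsuml; last first.
      by move=> r; rewrite EFinM nnfun_muleindic_ge0.
    by apply: eq_fsbigr => r _; rewrite !EFinM muleA.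
  rewrite ge0_integral_fsum//=; last 2 first.
  - by move=> r; apply: measurable_funeM.
  - move=> r w _; rewrite EFinM muleA mule_ge0 ?lee_fin//.
    exact: nnfun_muleindic_ge0.
  rewrite integral_nnsfun//= patch_setT sintegralE.
  apply: eq_fsbigr => r; rewrite inE => -[x _ <-].
  rewrite ge0_integralZl//= ?lee_fin// => [|w _].
    by rewrite HW//.
  by rewrite lee_fin mulr_ge0 ?indicE.
transitivity (limn (fun n => \int[mu]_w (f_ n (X w) * W w)%:E)).
  rewrite -monotone_convergence//.
  - apply: eq_integral => w _; apply/esym/cvg_lim => //.
    under eq_fun do rewrite EFinM.
    by rewrite EFinM; apply: cvgeZr.
  - by move=> n; apply/measurable_EFinP; exact: measurable_funM.
  - by move=> n w _; rewrite lee_fin mulr_ge0.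
  - move=> w _ m n mn; rewrite lee_fin ler_wpM2r//.
    exact/lefP/nd_nnsfun_approx.
under eq_fun do rewrite step.
rewrite -monotone_convergence//.
- by apply: eq_integral => w _; apply/cvg_lim.
- by move=> n; apply/measurable_EFinP; exact: measurable_funPT.
- by move=> n w _; rewrite lee_fin.
- by move=> w _ m n mn; rewrite lee_fin; exact/lefP/nd_nnsfun_approx.
Qed.

(** The product rule for events is the case of indicators, which are exchanged for general functions
    one coordinate at a time. *)
Lemma ge0_expectation_prod (n : nat) (X : 'I_n -> {RV P >-> R})
    (g : 'I_n -> R -> R) :
  (forall A : 'I_n -> set R, (forall i, measurable (A i)) ->
     P (\bigcap_(i in [set: 'I_n]) (X i @^-1` A i)) =
     \prod_(i < n) P (X i @^-1` A i)) ->
  (forall i, measurable_fun setT (g i)) -> (forall i x, (0 <= g i x)%R) ->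
  (forall i, \int[P]_w (g i (X i w))%:E \is a fin_num) ->
  \int[P]_w (\prod_(i < n) g i (X i w))%:E =
  \prod_(i < n) \int[P]_w (g i (X i w))%:E.
Proof.
move=> indX.
have mX i : measurable_fun setT (X i) by exact: measurable_funPT.
have PX i A : measurable A -> \int[P]_w (\1_A (X i w))%:E = P (X i @^-1` A).
  move=> mA.
  have := @integral_indic _ _ _ P setT measurableT (X i @^-1` A).
  rewrite setIT => <- //.
  by rewrite -[X in measurable X]setTI; exact: mX.
(* Induction on [k]: factors of index below [k] are arbitrary, the others are still indicators. *)
suff main k (f : 'I_n -> R -> R) : (forall i, measurable_fun setT (f i)) ->
    (forall i x, (0 <= f i x)%R) ->
    (forall i, \int[P]_w (f i (X i w))%:E \is a fin_num) ->
    (forall i : 'I_n, (k <= i)%N -> exists2 A, measurable A & f i = \1_A) ->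
    \int[P]_w (\prod_(i < n) f i (X i w))%:E =
    \prod_(i < n) \int[P]_w (f i (X i w))%:E.
  move=> mg g0 fing; apply: (main n) => // i.
  by rewrite leqNgt ltn_ord.
elim: k f => [|k IH] f mf f0 ffin find.
  have /choice[A /all_and2[mA fA]] i : exists A, measurable A /\ f i = \1_A.
    by have [A mA fA] := find i (leq0n _); exists A.
  under [RHS]eq_bigr => i _ do rewrite fA PX//.
  have mXA i : measurable (X i @^-1` A i).
    by rewrite -[Y in measurable Y]setTI; exact: mX.
  rewrite -indX//.
  have mI : measurable (\bigcap_(i in [set: 'I_n]) (X i @^-1` A i)).
    by apply: fin_bigcap_measurable => // i _; exact: mXA.
  have := @integral_indic _ _ _ P setT measurableT _ mI.
  rewrite setIT => <-; apply: eq_integral => w _; congr (_%:E).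
  under eq_bigr => i _ do rewrite fA.
  have [wA|/existsNP[i wA]] := pselect (forall i, A i (X i w)).
    rewrite big1 => [|i _]; rewrite indicE mem_set//.
    by move=> i _; exact: wA.
  rewrite (bigD1 i)//= indicE memNset// mul0r indicE memNset//.
  by move=> /(_ i Logic.I).
have [kn|nk] := ltnP k n; last first.
  apply: IH => // i ki; have := ltn_ord i.
  by rewrite ltnNge (leq_trans nk ki).
pose k0 := Ordinal kn.
rewrite (bigD1 k0)//=.
transitivity (\int[P]_w
    (f k0 (X k0 w) * \prod_(i < n | i != k0) f i (X i w))%:E).
  by apply: eq_integral => w _; rewrite (bigD1 k0).
have mI : measurable_fun setT (fun w => \prod_(i < n | i != k0) f i (X i w))%R.
  under eq_fun do rewrite -big_filter.
  by apply: measurable_prod => i _; exact: measurableT_comp.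
have If0 i : 0 <= \int[P]_w (f i (X i w))%:E.
  by apply: integral_ge0 => w _; rewrite lee_fin.
have c0 : (0 <= fine (\prod_(i < n | i != k0) \int[P]_w (f i (X i w))%:E))%R.
  by rewrite fine_ge0// prode_ge0.
(* [nu] is the law of [X k0] scaled by the product of the other expectations; the other factors act
   as the weight in [ge0_integral_density]. *)
pose nu := mscale (NngNum c0) (distribution P (X k0)).
transitivity (\int[nu]_x (f k0 x)%:E); last first.
  rewrite ge0_integral_mscale//=; last 2 first.
  - exact/measurable_EFinP.
  - by move=> x _; rewrite lee_fin.
  rewrite fineK ?prode_fin_num// muleC ge0_integral_distribution//.
  - exact/measurable_EFinP.
  - by move=> x; rewrite lee_fin.
apply: (@ge0_integral_density _ _ P nu (X k0) _ (f k0)) => //.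
  by move=> w; apply: prodr_ge0.
(* The family [f'] consists of indicators from index [k] on, so the induction hypothesis applies to
   it. *)
move=> A mA; pose f' i := if i == k0 then \1_A else f i.
have f'E w i : i != k0 -> f' i w = f i w by rewrite /f' => /negbTE ->.
have f'k : f' k0 = \1_A by rewrite /f' eqxx.
have := IH f' _ _ _ _; rewrite (bigD1 k0)//= f'k PX// => H.
rewrite /nu /mscale/= fineK ?prode_fin_num// muleC.
transitivity (P (X k0 @^-1` A) *
    \prod_(i < n | i != k0) \int[P]_w (f' i (X i w))%:E).
  rewrite -H => [||i x||i ki].
  - apply: eq_integral => w _; rewrite [in RHS](bigD1 k0)//= f'k.
    by congr (_ * _)%:E; apply: eq_bigr => i ik; rewrite f'E.
  - by move=> i; rewrite /f'; case: eqP => // _; exact: measurable_indic.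
  - by rewrite /f'; case: eqP => // _; rewrite indicE.
  - move=> i; rewrite /f'; case: eqP => // ->.
    rewrite PX// fin_num_measure//.
    by rewrite -[Y in measurable Y]setTI; exact: mX.
  - rewrite /f'; case: eqP => [_|/eqP ik]; first by exists A.
    apply: find; rewrite ltn_neqAle ki andbT; apply: contra ik => /eqP ik.
    exact/eqP/val_inj.
congr (_ * _); apply: eq_bigr => i ik.
by apply: eq_integral => w _; rewrite f'E.
Qed.

End Independence.

(** Completing the square: the exponentially tilted density is the right-hand constant times the
    normal density centred at [sigma ^+ 2 * t]. *)
Lemma normal_mgf (R : realType) (mu : {measure set R -> \bar R})
    (sigma t : R) : sigma != 0 ->
  (forall A, measurable A -> mu A = normal_prob 0 sigma A) ->
  (\int[mu]_x (expR (t * x))%:E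
    = (expR (sigma ^+ 2 * t ^+ 2 / 2))%:E)%E.
Proof.
move=> s0 muE.
have mpdf (m : R) : measurable_fun [set: R] (normal_pdf m sigma).
  exact: measurable_normal_pdf.
transitivity (\int[lebesgue_measure]_x
    (expR (t * x) * normal_pdf 0 sigma x)%:E)%E.
  have key := (@ge0_integral_density _ (measurableTypeR R) R _ R
    lebesgue_measure mu id (normal_pdf 0 sigma)
    (fun x => expR (t * x))).
  apply/esym; apply: key => //.
  + exact: mpdf.
  + by move=> x; exact: normal_pdf_ge0.
  + move=> A mA; rewrite muE// /normal_prob [RHS]integral_mkcond.
    apply: eq_integral => x _; rewrite patchE indicE.
    by case: ifPn; rewrite ?mul1r ?mul0r.
  + by apply: measurableT_comp => //; exact: measurable_funM.
transitivity (\int[lebesgue_measure]_x ((expR (sigma ^+ 2 * t ^+ 2 / 2))%:E *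
      (normal_pdf (sigma ^+ 2 * t) sigma x)%:E))%E.
  apply: eq_integral => x _; rewrite -EFinM !normal_pdfE//; congr (_%:E).
  rewrite mulrCA [RHS]mulrCA /normal_fun -!expRD; congr (_ * expR _).
  by field.
rewrite ge0_integralZl//=.
- by rewrite integral_normal_pdf mule1.
- by apply/measurable_EFinP; exact: mpdf.
- by move=> x _; rewrite lee_fin normal_pdf_ge0.
Qed.

(** The centred density is even and Lebesgue measure is invariant under negation. *)
Lemma normal_probN (R : realType) (sigma : R) (A : set R) : sigma != 0 ->
  measurable A ->
  normal_prob 0 sigma (-%R @^-1` A) = normal_prob 0 sigma A.
Proof.
move=> s0 mA; rewrite /normal_prob.
transitivity (\int[pushforward lebesgue_measure
  (-%R : _ -> measurableTypeR R)]_(x in A) (normal_pdf 0 sigma x)%:E)%E.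
  rewrite ge0_integral_pushforward//=.
  - apply: eq_integral => x _ /=; rewrite !normal_pdfE//.
    by rewrite /normal_fun !subr0 sqrrN.
  - by apply/measurable_EFinP; apply: measurable_funTS;
      exact: measurable_normal_pdf.
  - by move=> x _; rewrite lee_fin normal_pdf_ge0.
by apply: eq_measure_integral => B mB _; exact: lebesgue_measureN.
Qed.

Section GaussianLinear.
Context (d : measure_display) (T : measurableType d) (R : realType).
Context (P : probability T R) (n : nat) (sigma : R).
Variable eps : 'I_n -> {RV P >-> R}.
Hypothesis sigma_gt0 : 0 < sigma.
Hypothesis eps_gauss : isotropic_gaussian sigma eps.

Let sigma_neq0 : sigma != 0. Proof. by rewrite gt_eqF. Qed.

Lemma gaussian_linear_mgf (v : 'I_n -> R) (t : R) :
  (\int[P]_w (expR (t * \sum_i v i * eps i w))%:E =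
   (expR (sigma ^+ 2 * t ^+ 2 * (\sum_i v i ^+ 2) / 2))%:E)%E.
Proof.
have [marg indep] := eps_gauss.
have mexp i : measurable_fun [set: R] (fun x : R => expR (t * v i * x)).
  by apply: measurableT_comp => //; exact: measurable_funM.
have Ei i : (\int[P]_w (expR (t * v i * eps i w))%:E =
    (expR (sigma ^+ 2 * (t * v i) ^+ 2 / 2))%:E)%E.
  rewrite -(@normal_mgf _ (distribution P (eps i)))//; last exact: marg.
  rewrite ge0_integral_distribution//.
  exact/measurable_EFinP.
transitivity (\int[P]_w (\prod_(i < n) expR (t * v i * eps i w))%:E)%E.
  apply: eq_integral => w _; rewrite mulr_sumr expR_sum; congr (_%:E).
  by apply: eq_bigr => i _; rewrite mulrA.
rewrite (@ge0_expectation_prod _ _ _ P n eps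
  (fun i x => expR (t * v i * x)))//; last first.
  by move=> i; rewrite Ei.
under eq_bigr do rewrite Ei.
rewrite -(big_morph EFin (@EFinM R) erefl) -expR_sum.
congr (expR _)%:E; rewrite mulr_sumr mulr_suml; apply: eq_bigr => i _; ring.
Qed.

(** [eps] and its negative have the same joint law, so the form is as likely positive as negative,
    and the event that it vanishes falls on the favourable side. *)
Lemma gaussian_linear_half (v : 'I_n -> R) :
  ((2^-1)%:E <= P [set w | (\sum_i v i * eps i w <= 0)%R])%E.
Proof.
have [marg indep] := eps_gauss.
have me i : measurable_fun setT (eps i) by exact: measurable_funPT.
have mNe i : measurable_fun setT (fun w => - eps i w).
  exact: measurableT_comp.
(* The joint law lives on the sigma-algebra generated by boxes, the sets that the independence
   hypothesis speaks of. *)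
pose box (A : 'I_n -> set R) : set ('I_n -> R) := [set x | forall i, A i (x i)].
pose G : set (set ('I_n -> R)) :=
  [set B | exists2 A, (forall i, measurable (A i)) & B = box A].
pose U : measurableType G.-sigma := g_sigma_algebraType G.
have preboxE (f : 'I_n -> T -> R) A :
    (fun w i => f i w) @^-1` box A = \bigcap_(i in [set: 'I_n]) (f i @^-1` A i).
  by apply/seteqP; split => w /= H i; [move=> _|]; exact: H.
have mbox (f : 'I_n -> T -> R) : (forall i, measurable_fun setT (f i)) ->
    measurable_fun setT ((fun w i => f i w) : T -> U).
  move=> mf; have meas := @measurability _ _ T U setT (fun w i => f i w) G.
  apply meas => // _ [_ [A mA ->] <-].
  rewrite setTI preboxE; apply: fin_bigcap_measurable => // i _.
  by rewrite -[X in measurable X]setTI; exact: mf.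
have mcoord i : measurable_fun [set: U] (fun x : U => x i).
  move=> _ A mA; rewrite setTI; apply: sub_sigma_algebra.
  exists (fun j => if j == i then A else setT).
    by move=> j; case: ifP.
  apply/seteqP; split => x /= H; first by move=> j; case: eqP => // ->.
  by have := H i; rewrite eqxx.
pose S (x : U) := \sum_i v i * x i.
have mS : measurable_fun [set: U] S.
  by apply: measurable_sum => i; exact: measurable_funM.
pose e : T -> U := fun w i => eps i w.
pose e' : T -> U := fun w i => - eps i w.
have mE : measurable_fun setT e by exact: mbox.
have mE' : measurable_fun setT e' by exact: (mbox (fun i w => - eps i w)).
pose e_mfun : {mfun T >-> U} := HB.pack e (isMeasurableFun.Build _ _ _ _ _ mE).
pose e_mfun' : {mfun T >-> U} := HB.pack e' (isMeasurableFun.Build _ _ _ _ _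
  mE').
have PE (B : set U) : measurable B ->
    pushforward P e_mfun B = pushforward P e_mfun' B.
  (* Boxes are stable under intersection and the full space is one of them, so agreement on boxes is
     enough. *)
  apply: (@g_sigma_algebra_measure_unique _ _ U G _ (fun=> setT)) => //.
  - by move=> X GX; exact: sub_sigma_algebra.
  - move=> _; exists (fun=> setT) => //.
    by apply/seteqP; split.
  - by apply/seteqP; split => // x _; exists 0%N.
  - move=> _ _ [A mA ->] [B' mB ->]; exists (fun i => A i `&` B' i).
      by move=> i; exact: measurableI.
    apply/seteqP; split => [x [Ax Bx] i|x H]; first by split.
    by split => i; have [] := H i.
  - move=> _ [A mA ->]; change (P (e @^-1` box A) = P (e' @^-1` box A)).
    have -> : e @^-1` box A = \bigcap_(i in [set: 'I_n]) (eps i @^-1` A i).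
      exact: preboxE.
    have -> : e' @^-1` box A =
        \bigcap_(i in [set: 'I_n]) (eps i @^-1` (-%R @^-1` A i)).
      exact: (preboxE (fun i w => - eps i w)).
    have mNA i : measurable (-%R @^-1` A i).
      rewrite -[X in measurable X]setTI; exact: oppr_measurable.
    rewrite (indep _ mA) (indep _ mNA).
    apply: eq_bigr => i _.
    rewrite -[LHS]/(distribution P (eps i) (A i)) marg// -normal_probN//.
    exact/esym/marg.
  - by move=> _; rewrite /= /pushforward preimage_setT probability_setT ltry.
have PN : P [set w | S (e w) < 0] = P [set w | 0 < S (e w)].
  have mneg : measurable [set x : U | S x < 0].
    rewrite (_ : [set x | _] = setT `&` S @^-1` `]-oo, 0[); first exact: mS.
    by rewrite setTI; apply/seteqP; split => x /=; rewrite in_itv.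
  have := PE _ mneg; rewrite /pushforward/= => ->.
  congr (P _); apply/seteqP; split => w /=; rewrite /S /e'.
    by under eq_bigr do rewrite mulrN; rewrite sumrN oppr_lt0.
  by under [X in _ -> X < 0]eq_bigr do rewrite mulrN; rewrite sumrN oppr_lt0.
have mS0 (A : set R) : measurable A -> measurable ((S \o e) @^-1` A).
  by move=> mA; rewrite -[X in measurable X]setTI;
    exact: (measurableT_comp mS mE).
have mpos : measurable [set w | 0 < S (e w)].
  rewrite (_ : [set w | _] = (S \o e) @^-1` `]0, +oo[); first exact: mS0.
  by apply/seteqP; split => x /=; rewrite in_itv/= ?andbT.
have mneg : measurable [set w | S (e w) < 0].
  rewrite (_ : [set w | _] = (S \o e) @^-1` `]-oo, 0[); first exact: mS0.
  by apply/seteqP; split => x /=; rewrite in_itv.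
have mle : measurable [set w | S (e w) <= 0].
  rewrite (_ : [set w | _] = (S \o e) @^-1` `]-oo, 0]); first exact: mS0.
  by apply/seteqP; split => x /=; rewrite in_itv.
have : (P [set w | (0 < S (e w))%R] <= P [set w | (S (e w) <= 0)%R])%E.
  rewrite -PN; apply: le_measure; rewrite ?inE// => w /=; exact: ltW.
rewrite (_ : [set w | 0 < S (e w)] = ~` [set w | S (e w) <= 0]); last first.
  by apply/seteqP; split => w /=; rewrite ltNge => /negP.
rewrite probability_setC//.
rewrite -[P [set w | S (e w) <= 0]]fineK ?fin_num_measure//.
rewrite -EFinB !lee_fin; lra.
Qed.

End GaussianLinear.

(** Superlevel sets of [g] are open in the topology pulled back along [e], hence countable unions of
    boxes with rational centres and radii. *)
Lemma lipschitz_measurable (d : measure_display) (T : measurableType d)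
    (R : realType) (n : nat) (e : 'I_n -> T -> R) (g : T -> R) :
  (forall i, measurable_fun setT (e i)) ->
  (forall w w', g w - g w' <= \sum_i `|e i w - e i w'|) ->
  measurable_fun setT g.
Proof.
move=> me lip; apply: (measurability (@RGenOInfty.G R)) => [|].
  exact: RGenOInfty.measurableE.
move=> _ [_ [c ->] <-]; rewrite setTI.
pose box (x : {ffun 'I_n -> rat} * rat) : set T :=
  \bigcap_(i in [set: 'I_n]) [set w | `|e i w - ratr (x.1 i)| < ratr x.2].
have mbox x : measurable (box x).
  apply: fin_bigcap_measurable => // i _.
  rewrite (_ : [set w | _] = setT `&` e i @^-1`
      `]ratr (x.1 i) - ratr x.2, ratr (x.1 i) + ratr x.2[); first exact: me.
  by rewrite setTI; apply/seteqP; split => w /=; rewrite in_itv/= ltr_distl.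
have -> : g @^-1` `]c, +oo[%classic =
    \bigcup_(x in [set x | box x `<=` [set w | c < g w]]) box x.
  apply/seteqP; split => [w /=|w [x xs xw]]; last first.
    by rewrite /= in_itv/= andbT; exact: xs.
  rewrite in_itv/= andbT => cw.
  (* Two points of a box of radius [r] differ by less than [2 * r] in each coordinate, so [g] drops
     by at most [2 * n * r]; the [+ 1] keeps the denominator positive when [n = 0]. *)
  have : 0 < (g w - c) / (2 * n%:R + 1).
    by rewrite divr_gt0 ?subr_gt0// ltr_wpDl// mulr_ge0.
  move=> /rat_in_itvoo[r]; rewrite in_itv/= => /andP[r0 rd].
  have /choice[q qw] i : exists q : rat, `|e i w - ratr q| < ratr r.
    have : e i w - ratr r < e i w + ratr r by lra.
    move=> /rat_in_itvoo[q]; rewrite in_itv/= => qi; exists q.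
    by rewrite distrC ltr_distl.
  exists ([ffun i => q i], r); last by move=> i _ /=; rewrite ffunE.
  move=> w' /= w'b.
  have : \sum_i `|e i w - e i w'| <= \sum_(i < n) (2 * ratr r).
    apply: ler_sum => i _; have /= := w'b i Logic.I; rewrite ffunE => H.
    rewrite (le_trans (ler_distD (ratr (q i)) _ _))//.
    by have := qw i; rewrite (distrC (ratr (q i))); lra.
  rewrite sumr_const card_ord -mulr_natr => H.
  have := lip w w'; move: rd; rewrite ltr_pdivlMr; last first.
    by rewrite ltr_wpDl// mulr_ge0.
  lra.
rewrite bigcup_mkcond; apply: countable_bigcupT_measurable => // x.
by case: ifP.
Qed.

(** * Lasso minimizers *)

Lemma sum_sqr_ge0 (R : realType) (I : finType) (a : I -> R) :
  0 <= \sum_i a i ^+ 2.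
Proof. by apply: sumr_ge0 => i _; exact: sqr_ge0. Qed.

Lemma cauchy_schwarz_sum (R : realType) (I : finType) (a b : I -> R) :
  \sum_i a i * b i <= Num.sqrt (\sum_i a i ^+ 2) * Num.sqrt (\sum_i b i ^+ 2).
Proof.
have [Sa Sb] := (sum_sqr_ge0 a, sum_sqr_ge0 b).
rewrite -sqrtrM// (le_trans (ler_norm _))// -sqrtr_sqr ler_wsqrtr//.
rewrite expr2 -subr_ge0.
(* Lagrange's identity: this sum is twice the Cauchy-Schwarz defect. *)
have : 0 <= \sum_i \sum_j (a i * b j - a j * b i) ^+ 2.
  by apply: sumr_ge0 => i _; exact: sum_sqr_ge0.
have -> : \sum_i \sum_j (a i * b j - a j * b i) ^+ 2 =
    ((\sum_i a i ^+ 2) * (\sum_i b i ^+ 2) -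
     (\sum_i a i * b i) * (\sum_i a i * b i)) *+ 2.
  transitivity (\sum_i \sum_j (a i ^+ 2 * b j ^+ 2 + b i ^+ 2 * a j ^+ 2
      - 2 * ((a i * b i) * (a j * b j)))).
    by apply: eq_bigr => i _; apply: eq_bigr => j _; ring.
  under eq_bigr do rewrite sumrB big_split/= -!mulr_sumr.
  rewrite sumrB big_split/= -!mulr_suml -mulr_sumr -mulr_suml.
  ring.
by rewrite pmulrn_lge0.
Qed.

Section EuclideanNorm.
Context {R : realType}.

Definition cdot (m : nat) (u v : 'cV[R]_m) : R := \sum_i u i 0 * v i 0.

Variable m : nat.
Implicit Types u v w : 'cV[R]_m.

Lemma cdotC u v : cdot u v = cdot v u.
Proof. by apply: eq_bigr => i _; rewrite mulrC. Qed.

Lemma cdotDr u v w : cdot u (v + w) = cdot u v + cdot u w.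
Proof. by rewrite -big_split; apply: eq_bigr => i _; rewrite mxE mulrDr. Qed.

Lemma cdotZr u a v : cdot u (a *: v) = a * cdot u v.
Proof. by rewrite mulr_sumr; apply: eq_bigr => i _; rewrite mxE mulrCA. Qed.

Lemma cdotNr u v : cdot u (- v) = - cdot u v.
Proof. by rewrite -scaleN1r cdotZr mulN1r. Qed.

Lemma cdotDl u v w : cdot (u + v) w = cdot u w + cdot v w.
Proof. by rewrite cdotC cdotDr !(cdotC w). Qed.

Lemma cdotNl u v : cdot (- u) v = - cdot u v.
Proof. by rewrite cdotC cdotNr cdotC. Qed.

Lemma cdot_mulmx n (X : 'M[R]_(n, m)) (e : 'cV[R]_n) u :
  cdot e (X *m u) = cdot (X^T *m e) u.
Proof.
rewrite /cdot; under eq_bigr do rewrite mxE mulr_sumr.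
rewrite exchange_big; apply: eq_bigr => j _ /=.
by rewrite mxE mulr_suml; apply: eq_bigr => i _; rewrite mxE; ring.
Qed.

Lemma l2norm_ge0 u : 0 <= l2norm u.
Proof. exact: sqrtr_ge0. Qed.

Lemma l2norm_sqr u : l2norm u ^+ 2 = cdot u u.
Proof. by rewrite sqr_sqrtr ?sum_sqr_ge0. Qed.

Lemma cdot_le u v : cdot u v <= l2norm u * l2norm v.
Proof. exact: cauchy_schwarz_sum. Qed.

Lemma cdot_ge u v : - (l2norm u * l2norm v) <= cdot u v.
Proof.
rewrite lerNl -cdotNr (le_trans (cdot_le _ _))// ler_wpM2l ?l2norm_ge0//.
by rewrite /l2norm; under eq_bigr do rewrite mxE sqrrN.
Qed.

Lemma l2norm_sqrD u v :
  l2norm (u + v) ^+ 2 = l2norm u ^+ 2 + 2 * cdot u v + l2norm v ^+ 2.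
Proof. rewrite !l2norm_sqr cdotDl !cdotDr (cdotC v u); ring. Qed.

Lemma l2normZ a u : l2norm (a *: u) = `|a| * l2norm u.
Proof.
rewrite /l2norm -sqrtr_sqr -sqrtrM ?sqr_ge0// mulr_sumr.
by congr Num.sqrt; apply: eq_bigr => i _; rewrite mxE exprMn.
Qed.

Lemma l2normD u v : l2norm (u + v) <= l2norm u + l2norm v.
Proof.
rewrite -(@ler_pXn2r _ 2)// ?nnegrE ?addr_ge0 ?l2norm_ge0//.
by rewrite l2norm_sqrD; have := cdot_le u v; nra.
Qed.

Lemma l2norm_eq0 u : l2norm u = 0 -> u = 0.
Proof.
move=> /eqP; rewrite -sqrf_eq0 l2norm_sqr => /eqP u0; apply/colP => i;
  rewrite mxE.
apply/eqP; rewrite -sqrf_eq0 expr2.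
have /psumr_eq0P : forall j : 'I_m, true -> 0 <= u j 0 * u j 0.
  by move=> j _; rewrite -expr2 sqr_ge0.
by move=> /(_ u0 i erefl) ->.
Qed.

Lemma l2norm_le_sum u : l2norm u <= \sum_i `|u i 0|.
Proof.
have S0 : 0 <= \sum_i `|u i 0| by exact: sumr_ge0.
rewrite -(@ler_pXn2r _ 2)// ?nnegrE ?l2norm_ge0// l2norm_sqr expr2 mulr_sumr.
apply: ler_sum => i _; rewrite -expr2 -real_normK ?num_real// expr2.
rewrite ler_wpM2r//; rewrite (bigD1 i)//= lerDl; exact: sumr_ge0.
Qed.

End EuclideanNorm.

Section Lasso.
Context {R : realType}.

Lemma ge0_of_small_perturbation (a b : R) :
  (forall t, 0 < t <= 1 -> 0 <= a + t * b) -> 0 <= a.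
Proof.
move=> H; rewrite leNgt; apply/negP => a0.
have := ler_norm b; have := normr_ge0 b; set D := 1 + `|b| - a => nb lb.
have D0 : 0 < D by rewrite /D; lra.
(* For [a < 0] this [t] is admissible, and [a + t * b] keeps the sign of [a] because [D] exceeds
   [b]. *)
have /H : 0 < - a / D <= 1.
  by rewrite divr_gt0 ?oppr_gt0//= ler_pdivrMr// /D; lra.
rewrite (_ : _ + _ = a * (D - b) / D); last by field; rewrite gt_eqF.
by rewrite pmulr_lge0 ?invr_gt0// nmulr_rge0// /D; lra.
Qed.

Variables (n p : nat) (X : 'M[R]_(n, p)) (lambda : R).
Hypothesis lambda_ge0 : 0 <= lambda.

Lemma h_convex (b b' : 'cV[R]_p) (t : R) : 0 <= t <= 1 ->
  h n lambda (b + t *: (b' - b)) <= (1 - t) * h n lambda b + t * h n lambda b'.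
Proof.
move=> /andP[t0 t1]; rewrite /h.
have H : l1norm (b + t *: (b' - b)) <= (1 - t) * l1norm b + t * l1norm b'.
  rewrite /l1norm !mulr_sumr -big_split; apply: ler_sum => i _ /=; rewrite !mxE.
  rewrite (_ : b i 0 + _ = (1 - t) * b i 0 + t * b' i 0); last by ring.
  by rewrite (le_trans (ler_normD _ _))// !normrM (ger0_norm t0)
    (@ger0_norm _ (1 - t)) ?subr_ge0.
have := sqrtr_ge0 n%:R => H2.
have H3 : 0 <= Num.sqrt n%:R * lambda by rewrite mulr_ge0.
have := ler_wpM2l H3 H; lra.
Qed.

(** First-order optimality without subgradients: compare [bh] with points of the segment towards
    [b], bound [h] there by convexity, divide by [t] and let the quadratic term vanish. *)
Lemma lasso_variational (y : 'cV[R]_n) (bh b : 'cV[R]_p) :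
  argmin (lasso_objective X lambda y) bh ->
  0 <= cdot (X *m bh - y) (X *m (b - bh)) + h n lambda b - h n lambda bh.
Proof.
move=> bhmin.
apply: (@ge0_of_small_perturbation _ (l2norm (X *m (b - bh)) ^+ 2 / 2)) => t.
move=> /andP[t0 t1]; rewrite -(pmulr_rge0 _ t0).
have := bhmin (bh + t *: (b - bh)); rewrite /lasso_objective.
have := @h_convex bh b t; rewrite (ltW t0) t1 => /(_ erefl).
rewrite mulmxDr -scalemxAr addrAC.
rewrite (l2norm_sqrD (X *m bh - y)) cdotZr l2normZ (gtr0_norm t0).
set A := l2norm (X *m bh - y); set B := l2norm (X *m (b - bh)).
set C := cdot _ _; set h1 := h _ _ (_ + _); nra.
Qed.

(** Adding the two variational inequalities, each tested at the other minimizer, cancels the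
    penalties. *)
Lemma lasso_fit_lipschitz (y y' : 'cV[R]_n) (bh bh' : 'cV[R]_p) :
  argmin (lasso_objective X lambda y) bh ->
  argmin (lasso_objective X lambda y') bh' ->
  l2norm (X *m (bh - bh')) <= l2norm (y - y').
Proof.
move=> m1 m2; have := lasso_variational bh' m1; have := lasso_variational bh m2.
have -> : X *m (bh' - bh) = - (X *m (bh - bh')) by rewrite -mulmxN opprB.
rewrite cdotNr.
have key : cdot (X *m bh' - y') (X *m (bh - bh')) -
    cdot (X *m bh - y) (X *m (bh - bh')) =
    cdot (y - y') (X *m (bh - bh')) - l2norm (X *m (bh - bh')) ^+ 2.
  rewrite l2norm_sqr -!cdotNl -!cdotDl; congr cdot; rewrite mulmxBr.
  by move: (X *m bh) (X *m bh') => U V; apply/colP => i; rewrite !mxE; ring.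
have := cdot_le (y - y') (X *m (bh - bh')).
have := l2norm_ge0 (X *m (bh - bh')); have := l2norm_ge0 (y - y').
set a := l2norm (X *m _) in key *; set b := l2norm _ in key *.
move=> b0 a0 cs k1 k2; have H : a ^+ 2 <= b * a by lra.
rewrite leNgt; apply/negP => ba; nra.
Qed.

End Lasso.

(** * Restricted isometry and eigenvalue constants *)

Section DesignConstants.
Context {R : realType}.
Variables (n p : nat) (X : 'M[R]_(n, p)).

Lemma delta_ge0 s : 0 <= delta X s.
Proof.
rewrite /delta; set S := [set d | _].
have [->|S0] := eqVneq S set0; first by rewrite inf0.
by apply: lb_le_inf; [exact/set0P|move=> x []].
Qed.

Hypothesis n_gt0 : (0 < n)%N.

(** For nonzero [b] the normalized ratio of norms minus 1 is a lower bound of the set defining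
    [delta], hence at most its infimum once the set is known to be nonempty. *)
Lemma l2norm_mulmx_delta s (b : 'cV[R]_p) : (l0norm b <= s)%N ->
  l2norm (X *m b) <= Num.sqrt n%:R * (1 + delta X s) * l2norm b.
Proof.
move=> bs.
have n0 : 0 < Num.sqrt n%:R :> R by rewrite sqrtr_gt0 ltr0n.
have [b0|b0] := eqVneq (l2norm b) 0.
  rewrite (l2norm_eq0 b0) mulmx0 -[X in l2norm X <= _](scale0r 0) l2normZ.
  by rewrite normr0 mul0r -[X in l2norm X](scale0r 0) l2normZ normr0 mul0r
    mulr0.
have {}b0 : 0 < l2norm b by rewrite lt_neqAle eq_sym b0 l2norm_ge0.
rewrite -ler_pdivrMr// -ler_pdivrMl// mulrC -lerBlDl.
apply: lb_le_inf; last first.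
  move=> d [d0 /(_ b bs)/andP[_ H]]; rewrite lerBlDl.
  by rewrite mulrAC ler_pdivrMr// mulrC.
(* [F] is the squared Frobenius norm, whose root bounds the operator norm; it provides an element of
   the set. *)
pose F := \sum_i l2norm (row i X)^T ^+ 2.
have F0 : 0 <= F by apply: sumr_ge0 => i _; exact: sqr_ge0.
have XF (c : 'cV[R]_p) : l2norm (X *m c) <= Num.sqrt F * l2norm c.
  rewrite -(@ler_pXn2r _ 2)// ?nnegrE ?mulr_ge0 ?sqrtr_ge0 ?l2norm_ge0//.
  rewrite exprMn (sqr_sqrtr F0) /F mulr_suml (l2norm_sqr (X *m c)).
  apply: ler_sum => i _; rewrite -expr2 -exprMn.
  have -> : (X *m c) i 0 = cdot (row i X)^T c.
    by rewrite mxE; apply: eq_bigr => j _; rewrite !mxE.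
  rewrite -real_normK ?num_real// ler_pXn2r ?nnegrE ?mulr_ge0 ?l2norm_ge0//.
  by rewrite ler_norml cdot_le cdot_ge.
(* The summand 1 makes the lower isometry bound trivial, its left side being nonpositive. *)
exists (1 + (Num.sqrt n%:R)^-1 * Num.sqrt F) => /=; split.
  by rewrite addr_ge0// mulr_ge0 ?invr_ge0 ?sqrtr_ge0// ltW.
move=> c _; have c0 := l2norm_ge0 c.
have k0 : 0 <= (Num.sqrt n%:R)^-1 :> R by rewrite invr_ge0 ltW.
have H := ler_wpM2l k0 (XF c).
have H2 : 0 <= (Num.sqrt n%:R)^-1 * l2norm (X *m c).
  by rewrite mulr_ge0 ?l2norm_ge0// invr_ge0 ltW.
have H3 : 0 <= (Num.sqrt n%:R)^-1 * Num.sqrt F.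
  by rewrite mulr_ge0 ?invr_ge0 ?sqrtr_ge0// ltW.
move: H H3 H2; rewrite mulrA; set q := _ * Num.sqrt F;
  set a := _ * l2norm (X *m c).
move=> H q0 a0; have qc : 0 <= q * l2norm c by exact: mulr_ge0.
apply/andP; split; lra.
Qed.

Lemma kappa_ge0 c0 s : 0 <= kappa X c0 s.
Proof.
rewrite /kappa; set S := [set _ | _ in _].
have [->|S0] := eqVneq S set0; first by rewrite inf0.
apply: lb_le_inf; first exact/set0P.
by move=> _ [a _ <-]; rewrite divr_ge0 ?mulr_ge0 ?l2norm_ge0 ?sqrtr_ge0.
Qed.

Lemma kappa_le c0 s (u : 'cV[R]_p) : RE_cone c0 s u ->
  kappa X c0 s * (Num.sqrt n%:R * l2norm u) <= l2norm (X *m u).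
Proof.
move=> uC; have [u0 _] := uC.
have nu : 0 < Num.sqrt n%:R * l2norm u.
  apply: mulr_gt0; first by rewrite sqrtr_gt0 ltr0n.
  rewrite lt_neqAle l2norm_ge0 andbT eq_sym.
  by apply: contra u0 => /eqP/l2norm_eq0 ->.
rewrite -ler_pdivlMr//; apply: ge_inf; last by exists u.
exists 0 => _ [a _ <-].
by rewrite divr_ge0 ?mulr_ge0 ?l2norm_ge0 ?sqrtr_ge0.
Qed.

End DesignConstants.

(** Clip the moduli at the [s]-th largest one, [t], found at index [s.-1]. In sorted order the
    clipped sum is [t *+ s] plus the tail; split along [S], its part on [S] is at most [t *+ s]. *)
Lemma rearrangement_tail (R : realType) (p s : nat) (u : 'cV[R]_p)
    (S : pred 'I_p) : (0 < s)%N -> #|S| = s ->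
  \sum_(s <= j < p) (rearrangement u)`_j <= \sum_(i | ~~ S i) `|u i 0|.
Proof.
move=> s0 cS.
have sp : (s <= p)%N by rewrite -cS -[p in (_ <= p)%N]card_ord max_card.
set r := rearrangement u.
have szr : size r = p by rewrite size_sort size_map -cardE card_ord.
have geR : total (fun x y : R => y <= x) by move=> x y; exact: le_total.
have rsort : sorted (fun x y : R => y <= x) r by exact: sort_sorted.
have rle i j : (i <= j)%N -> (j < p)%N -> r`_j <= r`_i.
  move=> ij jp.
  have := @sorted_leq_nth _ (fun x y : R => y <= x) _ _ 0 r rsort i j.
  apply => //; rewrite ?inE ?szr//.
  - by move=> x y z /= xy yz; exact: le_trans yz xy.
  - exact: leq_ltn_trans ij jp.
pose t := r`_s.-1.
(* Clipping the entries at the threshold t only changes the s largest ones. *)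
have clip : \sum_(0 <= j < p) Num.min r`_j t = \sum_i Num.min `|u i 0| t.
  transitivity (\sum_(x <- r) Num.min x t).
    by rewrite [RHS](big_nth 0) szr.
  rewrite (perm_big [seq `|u i 0| | i <- enum 'I_p]) /=;
    last by rewrite perm_sort.
  by rewrite big_map big_enum.
have : \sum_(0 <= j < p) Num.min r`_j t = t *+ s + \sum_(s <= j < p) r`_j.
  rewrite (big_cat_nat _ sp)//=; congr (_ + _).
    rewrite (eq_big_nat _ _ (F2 := fun=> t));
      first by rewrite sumr_const_nat subn0.
    move=> j /andP[_ js]; apply/min_idPr; apply: rle;
      first by rewrite -ltnS prednK.
    by rewrite prednK.
  apply: eq_big_nat => j /andP[sj jp]; apply/min_idPl; apply: rle => //.
  exact: leq_trans (leq_pred s) sj.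
rewrite clip (bigID S)/= => H.
have H1 : \sum_(i | S i) Num.min `|u i 0| t <= t *+ s.
  rewrite -cS -sumr_const; apply: ler_sum => i _.
  by rewrite ge_min lexx orbT.
have H2 : \sum_(i | ~~ S i) Num.min `|u i 0| t <= \sum_(i | ~~ S i) `|u i 0|.
  by apply: ler_sum => i _; rewrite ge_min lexx.
lra.
Qed.

(** Off [S] each modulus of [f] is at most [l] plus its excess over [l]: the level pays for the l1
    term and Cauchy-Schwarz handles the rest. *)
Lemma noise_bound (R : realType) (p : nat) (f u : 'cV[R]_p) (S : pred 'I_p)
    (l : R) : 0 <= l ->
  cdot f u <= Num.sqrt (\sum_(i | S i) f i 0 ^+ 2 +
      \sum_(i | ~~ S i) Num.max (`|f i 0| - l) 0 ^+ 2) * l2norm u +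
    l * \sum_(i | ~~ S i) `|u i 0|.
Proof.
move=> l0.
pose g i := if S i then `|f i 0| else Num.max (`|f i 0| - l) 0.
have -> : \sum_(i | S i) f i 0 ^+ 2 +
    \sum_(i | ~~ S i) Num.max (`|f i 0| - l) 0 ^+ 2 = \sum_i g i ^+ 2.
  rewrite [RHS](bigID S)/=; congr (_ + _); apply: eq_bigr => i; rewrite /g.
    by move=> ->; rewrite real_normK ?num_real.
  by move/negbTE ->.
have uE : l2norm u = Num.sqrt (\sum_i `|u i 0| ^+ 2).
  by congr Num.sqrt; apply: eq_bigr => i _; rewrite real_normK ?num_real.
apply: (@le_trans _ _ (\sum_i g i * `|u i 0| + l * \sum_(i | ~~ S i) `|u i 0|)).
  rewrite mulr_sumr /cdot (bigID S)/= [X in _ <= X + _](bigID S)/= -addrA.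
  rewrite -big_split/=; apply: lerD; apply: ler_sum => i; rewrite /g.
    by move=> ->; rewrite -normrM ler_norm.
  move=> /negbTE ->; rewrite -mulrDl (le_trans (ler_norm _))// normrM.
  rewrite ler_wpM2r//; have := ler_norm (`|f i 0| - l).
  by rewrite maxEle; case: ifPn; rewrite -?ltNge; lra.
by rewrite lerD2r uE; exact: cauchy_schwarz_sum.
Qed.

(** * Sub-Gaussian moments and the noise event *)

Lemma expR_ge_quadratic (R : realType) (x : R) : 0 <= x ->
  1 + x + x ^+ 2 / 2 <= expR x.
Proof.
move=> x0; have -> : 1 + x + x ^+ 2 / 2 = series (exp_coeff x) 3.
  rewrite /series/= !big_nat_recr//= big_nil /exp_coeff/=.
  by rewrite !factS fact0 !muln1/= expr0 expr1 add0r !divr1.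
apply: nondecreasing_cvgn_le; last exact: is_cvg_series_exp_coeff.
by apply/nondecreasing_series => n _ _; exact: exp_coeff_ge0.
Qed.

(** Converts second moments into exponential ones. The right side minus 2 is the square of
    [expR (x / 2) - expR (- (x / 2))], which is at least [x] for [x >= 0]. *)
Lemma sqr_le_cosh (R : realType) (x : R) : x ^+ 2 + 2 <= expR x + expR (- x).
Proof.
wlog x0 : x / 0 <= x.
  move=> H; have [|/ltW x0] := leP 0 x; first exact: H.
  have := H (- x); rewrite oppr_ge0 sqrrN opprK => /(_ x0) H'.
  lra.
have sinh : x <= expR (x / 2) - expR (- (x / 2)).
  have h0 : 0 <= x / 2 by rewrite divr_ge0.
  have H := expR_ge_quadratic h0.
  have E : expR (x / 2) * expR (- (x / 2)) = 1 by rewrite expRxMexpNx_1.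
  have := expR_gt0 (- (x / 2)); set a := expR _ in H E *;
    set b := expR _ in E *.
  move=> b0; rewrite (_ : x = 2 * (x / 2)); last by field.
  move: H h0; set y := x / 2 => H h0.
  have q0 : 0 <= 1 - y + y ^+ 2 / 2 by nra.
  have bq : b * (1 + y + y ^+ 2 / 2) <= 1.
    by have := ler_wpM2l (ltW b0) H; rewrite (mulrC b a) E.
  (* The product of the two quadratics is at least 1, which turns the lower bound on [expR y] into
     an upper bound on [expR (- y)]. *)
  have b1 : b <= b * ((1 + y + y ^+ 2 / 2) * (1 - y + y ^+ 2 / 2)).
    apply: ler_peMr; first exact: ltW.
    rewrite (_ : _ * _ = 1 + (y ^+ 2) ^+ 2 / 4); last by field.
    by rewrite lerDl divr_ge0// sqr_ge0.
  have := ler_wpM2r q0 bq; rewrite mul1r -mulrA; lra.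
have -> : expR x = expR (x / 2) ^+ 2 by rewrite -expRM_natr; congr expR; field.
have -> : expR (- x) = expR (- (x / 2)) ^+ 2 by rewrite -expRM_natr;
  congr expR; field.
have E : expR (x / 2) * expR (- (x / 2)) = 1 by rewrite expRxMexpNx_1.
have := expR_gt0 (- (x / 2)); have := expR_gt0 (x / 2).
nra.
Qed.

Section SubGaussian.
Context (d : measure_display) (T : measurableType d) (R : realType).
Variable P : probability T R.

Lemma markov_complement (Z : T -> R) (a c : R) : 0 < a ->
  measurable_fun setT Z -> (forall w, 0 <= Z w) ->
  (\int[P]_w (Z w)%:E <= (c * a)%:E)%E ->
  ((1 - c)%:E <= P [set w | (Z w <= a)%R])%E.
Proof.
move=> a0 mZ Z0 IZ.
have mle : measurable [set w | Z w <= a].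
  rewrite (_ : [set w | _] = setT `&` Z @^-1` `]-oo, a]); first exact: mZ.
  by rewrite setTI; apply/seteqP; split => x /=; rewrite in_itv.
set A := ~` [set w | Z w <= a].
have mA : measurable A by exact: measurableC.
have : (a%:E * P A <= (c * a)%:E)%E.
  apply: le_trans IZ.
  have <- : (\int[P]_w (a%:E * (\1_A w)%:E))%E = (a%:E * P A)%E.
    rewrite ge0_integralZl//=; last 2 first.
    - exact/measurable_EFinP.
    - by rewrite lee_fin ltW.
    by rewrite integral_indic// setIT.
  apply: ge0_le_integral => //.
  - by move=> w _; rewrite -EFinM lee_fin mulr_ge0 ?indicE// ltW.
  - by apply: measurable_funeM; exact/measurable_EFinP.
  - exact/measurable_EFinP.
  - move=> w _; rewrite -EFinM lee_fin indicE.
    have [/set_mem|_] := boolP (w \in A); last by rewrite mulr0.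
    by rewrite mulr1 /A /= => /negP; rewrite -ltNge => /ltW.
rewrite probability_setC//.
rewrite -[P [set w | Z w <= a]]fineK ?fin_num_measure// -EFinB -EFinM !lee_fin.
by rewrite mulrC ler_pM2r//; lra.
Qed.

Variables (F : T -> R) (tau : R).
Hypothesis tau_gt0 : 0 < tau.
Hypothesis mF : measurable_fun setT F.
Hypothesis mgfF : forall t,
  (\int[P]_w (expR (t * F w))%:E <= (expR (tau ^+ 2 * t ^+ 2 / 2))%:E)%E.

Let mexp t c : measurable_fun setT (fun w => expR (t * F w + c)).
Proof.
by apply: measurableT_comp => //; apply: measurable_funD => //;
  exact: measurable_funM.
Qed.

Let mgf_shift t c :
  (\int[P]_w (expR (t * F w + c))%:E <=
    (expR (tau ^+ 2 * t ^+ 2 / 2 + c))%:E)%E.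
Proof.
under eq_integral do rewrite expRD mulrC EFinM.
rewrite ge0_integralZl//=.
- by rewrite expRD mulrC EFinM; apply: lee_wpmul2l => //;
    rewrite lee_fin expR_ge0.
- apply/measurable_EFinP; have := mexp t 0.
  by under eq_fun do rewrite addr0.
Qed.

(** Domination by two opposite exponentials, integrated with [mgfF]. The constant [r] stays on the
    left so that every integrand is nonnegative. *)
Let exp2_bound (G : T -> R) (k r t c v : R) : 0 <= k ->
  measurable_fun setT G -> (forall w, 0 <= G w) -> 0 <= r ->
  (forall w, G w + r <= k * (expR (t * F w + c) + expR (- t * F w + c))) ->
  k * (2 * expR (tau ^+ 2 * t ^+ 2 / 2 + c)) <= v + r ->
  (\int[P]_w (G w)%:E <= v%:E)%E.
Proof.
move=> k0 mG G0 r0 GE kv.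
have mS : measurable_fun setT (fun w =>
    ((expR (t * F w + c))%:E + (expR (- t * F w + c))%:E)%E).
  under eq_fun do rewrite -EFinD.
  by apply/measurable_EFinP; exact: measurable_funD.
have : (\int[P]_w (G w)%:E + r%:E <= (v + r)%:E)%E.
  have -> : (\int[P]_w (G w)%:E + r%:E = \int[P]_w ((G w)%:E + r%:E))%E.
    rewrite ge0_integralD//=; last 2 first.
    - by move=> w _; rewrite lee_fin.
    - exact/measurable_EFinP.
    by rewrite integral_cst//= probability_setT mule1.
  apply: (@le_trans _ _ (\int[P]_w (k%:E * ((expR (t * F w + c))%:E +
      (expR (- t * F w + c))%:E)))%E).
    apply: ge0_le_integral => //.
    - by move=> w _; rewrite -EFinD lee_fin addr_ge0.
    - under eq_fun do rewrite -EFinD.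
      by apply/measurable_EFinP; exact: measurable_funD.
    - exact: measurable_funeM.
    - by move=> w _; rewrite -!EFinD -EFinM lee_fin.
  rewrite ge0_integralZl//; last first.
    by move=> w _; rewrite -EFinD lee_fin addr_ge0 ?expR_ge0.
  rewrite ge0_integralD//; last 2 first.
  - exact/measurable_EFinP.
  - exact/measurable_EFinP.
  apply: (@le_trans _ _ (k%:E * (expR (tau ^+ 2 * t ^+ 2 / 2 + c) +
      expR (tau ^+ 2 * (- t) ^+ 2 / 2 + c))%:E)%E).
    by apply: lee_wpmul2l; rewrite ?lee_fin// EFinD; apply: leeD;
      exact: mgf_shift.
  by rewrite -EFinM lee_fin sqrrN; apply: le_trans kv; rewrite mulr_natl mulr2n.
by rewrite EFinD leeD2rE.
Qed.

(** With [t = (2 * tau)^-1] the domination gives [8 * tau ^+ 2 * (expR 8^-1 - 1)], and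
    [expR 8^-1 <= 8 / 7]. *)
Lemma subgaussian_second_moment :
  (\int[P]_w (F w ^+ 2)%:E <= (8 / 7 * tau ^+ 2)%:E)%E.
Proof.
apply: (@exp2_bound _ (4 * tau ^+ 2) (8 * tau ^+ 2) (2 * tau)^-1 0).
- by rewrite mulr_ge0// sqr_ge0.
- exact: measurable_funX.
- by move=> w; exact: sqr_ge0.
- by rewrite mulr_ge0// sqr_ge0.
- move=> w; rewrite !addr0; have := sqr_le_cosh ((2 * tau)^-1 * F w).
  rewrite mulNr; set e := expR _ + _ => H.
  have -> : F w ^+ 2 + 8 * tau ^+ 2 =
      4 * tau ^+ 2 * (((2 * tau)^-1 * F w) ^+ 2 + 2).
    by field; rewrite gt_eqF.
  by rewrite ler_wpM2l// mulr_ge0// sqr_ge0.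
- rewrite addr0 (_ : tau ^+ 2 * _ / 2 = 8^-1); last by field; rewrite gt_eqF.
  have := expR_ge1Dx (- 8^-1 : R); rewrite expRN => H.
  have e0 := expR_gt0 (8^-1 : R).
  have : expR 8^-1 <= 8 / 7 :> R.
    have := mulfV (lt0r_neq0 e0); nra.
  by have := sqr_ge0 tau; nra.
Qed.

(** Since [x ^+ 2 <= 2 * expR x] for [x >= 0], the squared excess is at most [2 / th ^+ 2] times the
    two exponentials shifted by [- (th * l)]. *)
Lemma subgaussian_excess (L l : R) : 0 < L -> tau * L <= l ->
  (\int[P]_w (Num.max (`|F w| - l) 0 ^+ 2)%:E <=
    (4 * tau ^+ 2 / L ^+ 2 * expR (- (L ^+ 2 / 2)))%:E)%E.
Proof.
(* This [th] minimizes the exponent [tau ^+ 2 * th ^+ 2 / 2 - th * tau * L], with value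
   [- (L ^+ 2 / 2)]. *)
move=> L0 Ll; pose th := L / tau.
have th0 : 0 < th by rewrite divr_gt0.
apply: (@exp2_bound _ (2 / th ^+ 2) 0 th (- (th * l))) => //.
- by rewrite divr_ge0// sqr_ge0.
- apply: measurable_funX; apply: measurable_maxr => //.
  by apply: measurable_funB => //; exact: measurableT_comp.
- by move=> w; exact: sqr_ge0.
- move=> w; rewrite addr0.
  have e1 := expR_ge0 (th * F w + - (th * l)).
  have e2 := expR_ge0 (- th * F w + - (th * l)).
  have [Fl|lF] := leP (`|F w| - l) 0.
    by rewrite expr0n/= mulr_ge0 ?addr_ge0 ?divr_ge0 ?sqr_ge0.
  have y0 : 0 <= th * (`|F w| - l) by rewrite mulr_ge0// ltW.
  have := expR_ge1Dxn 1 y0; rewrite !factS fact0 !muln1/=.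
  have : expR (th * (`|F w| - l)) <=
    expR (th * F w - th * l) + expR (- th * F w - th * l).
    have [F0|F0] := leP 0 (F w); rewrite ?(ger0_norm F0) ?(ltr0_norm F0) mulrBr.
      by rewrite lerDl.
    by rewrite mulrN mulNr lerDr.
  set e := expR _ + _ => H1 H2.
  rewrite mulrAC ler_pdivlMr ?exprn_gt0// -exprMn mulrC.
  by move: H1 H2; rewrite mulrC; lra.
- rewrite addr0.
  have -> : 4 * tau ^+ 2 / L ^+ 2 * expR (- (L ^+ 2 / 2)) =
      2 / th ^+ 2 * (2 * expR (- (L ^+ 2 / 2))).
    by rewrite /th; field; rewrite !gt_eqF.
  rewrite ler_wpM2l ?divr_ge0 ?sqr_ge0// ler_wpM2l// ler_expR.
  have -> : tau ^+ 2 * th ^+ 2 / 2 = L ^+ 2 / 2 by rewrite /th; field;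
    rewrite gt_eqF.
  have : th * (tau * L) <= th * l by rewrite ler_wpM2l// ltW.
  rewrite (_ : th * (tau * L) = L ^+ 2); last by rewrite /th; field;
    rewrite gt_eqF.
  lra.
Qed.

End SubGaussian.

Lemma expR1_ge2 (R : realType) : 2 <= expR 1 :> R.
Proof. by have := expR_ge1Dx (1 : R). Qed.

Section LogTerm.
Variables (R : realType) (p s : nat).
Hypotheses (s_gt0 : (0 < s)%N) (s_le_p : (s <= p)%N).

Let arg_gt0 : 0 < 9 * expR 1 * p%:R / s%:R :> R.
Proof.
by rewrite divr_gt0 ?ltr0n// mulr_gt0 ?ltr0n ?(leq_trans s_gt0)// mulr_gt0
  ?expR_gt0.
Qed.

Lemma log_term_ge1 : 1 <= log_term R p s.
Proof.
rewrite -[1]expRK ler_ln ?posrE ?expR_gt0//.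
rewrite ler_pdivlMr ?ltr0n//.
have : s%:R <= p%:R :> R by rewrite ler_nat.
have := expR_gt0 (1 : R); have : 0 < s%:R :> R by rewrite ltr0n.
set a := s%:R; set b := p%:R; set e := expR 1; nra.
Qed.

Lemma expR_log_term : expR (- log_term R p s) = s%:R / (9 * expR 1 * p%:R).
Proof. by rewrite expRN lnK ?posrE// invf_div. Qed.

End LogTerm.

Section NoiseEvent.
Context (d : measure_display) (T : measurableType d) (R : realType).
Context (P : probability T R) (n p : nat) (sigma : R).
Variable eps : 'I_n -> {RV P >-> R}.
Hypothesis sigma_gt0 : 0 < sigma.
Hypothesis eps_gauss : isotropic_gaussian sigma eps.
Variables (a : 'I_p -> 'I_n -> R) (S : pred 'I_p) (s : nat) (tau l : R).
Hypothesis tau_gt0 : 0 < tau.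
Hypothesis a_tau : forall j, sigma ^+ 2 * \sum_i a j i ^+ 2 <= tau ^+ 2.
Hypothesis cardS : #|S| = s.
Hypothesis s_gt0 : (0 < s)%N.
Hypothesis tau_l : tau * (1 + Num.sqrt (2 * log_term R p s)) <= l.

(** The quantity under the root in [noise_bound], for general linear forms that later become the
    coordinates of [score]. *)
Definition excess (w : T) : R :=
  \sum_(j | S j) (\sum_i a j i * eps i w) ^+ 2 +
  \sum_(j | ~~ S j) Num.max (`|\sum_i a j i * eps i w| - l) 0 ^+ 2.

Let G j (w : T) : R := if S j then (\sum_i a j i * eps i w) ^+ 2
  else Num.max (`|\sum_i a j i * eps i w| - l) 0 ^+ 2.

Let excessE w : excess w = \sum_j G j w.
Proof.
rewrite /excess [RHS](bigID S)/=; congr (_ + _); apply: eq_bigr => j;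
  rewrite /G.
  by move=> ->.
by move=> /negbTE ->.
Qed.

Let mform j : measurable_fun setT (fun w => \sum_i a j i * eps i w).
Proof.
apply: measurable_sum => i; apply: measurable_funM => //.
Qed.

Let mG j : measurable_fun setT (G j).
Proof.
rewrite /G; case: (S j); apply: measurable_funX; first exact: mform.
apply: measurable_maxr => //; apply: measurable_funB => //.
exact: measurableT_comp.
Qed.

Lemma measurable_excess : measurable_fun setT excess.
Proof.
rewrite (_ : excess = fun w => \sum_j G j w); last exact/funext/excessE.
exact: measurable_sum.
Qed.

(** The mean of [excess] is at most [(8 / 7 + 1 / 18) * s * tau ^+ 2], below the
    [0.24 * 6 * s * tau ^+ 2] that Markov's inequality allows. *)
Lemma excess_prob :
  ((76 / 100)%:E <= P [set w | (excess w <= 6 * s%:R * tau ^+ 2)%R])%E.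
Proof.
have sp : (s <= p)%N by rewrite -cardS -[p in (_ <= p)%N]card_ord max_card.
have s0 : 0 < s%:R :> R by rewrite ltr0n.
have p0 : 0 < p%:R :> R by rewrite ltr0n (leq_trans s_gt0).
have G0 j w : 0 <= G j w by rewrite /G; case: ifP => _; exact: sqr_ge0.
have -> : 76 / 100 = 1 - 24 / 100 :> R by field.
apply: markov_complement.
- by rewrite !mulr_gt0// exprn_gt0.
- exact: measurable_excess.
- by move=> w; rewrite excessE sumr_ge0.
pose bnd j : R :=
  if S j then 8 / 7 * tau ^+ 2 else tau ^+ 2 * (s%:R / p%:R) / 18.
have IG j : (\int[P]_w (G j w)%:E <= (bnd j)%:E)%E.
  have mgf t : (\int[P]_w (expR (t * \sum_i a j i * eps i w))%:E <=
      (expR (tau ^+ 2 * t ^+ 2 / 2))%:E)%E.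
    rewrite (gaussian_linear_mgf sigma_gt0 eps_gauss) lee_fin ler_expR.
    rewrite ler_wpM2r// mulrAC ler_wpM2r ?sqr_ge0//.
  rewrite /G /bnd; case: (S j).
    exact: subgaussian_second_moment.
  have M1 : 1 <= Num.sqrt (2 * log_term R p s).
    rewrite -[leLHS]sqrtr1 ler_wsqrtr//; have := @log_term_ge1 R p s s_gt0 sp;
      lra.
  have tl := tau_l; set M := Num.sqrt _ in tl M1.
  have MM : M ^+ 2 = 2 * log_term R p s.
    by rewrite sqr_sqrtr// mulr_ge0//; have := @log_term_ge1 R p s s_gt0 sp;
      lra.
  apply: (le_trans (subgaussian_excess tau_gt0 (mform j) mgf _ tl));
    first by lra.
  rewrite lee_fin.
  (* [(1 + M) ^+ 2 / 2] is at least [M ^+ 2 / 2], the log term, and 18 comes from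
     [9 * expR 1 >= 18]. *)
  have H1 : expR (- ((1 + M) ^+ 2 / 2)) <= s%:R / p%:R / 18.
    apply: (@le_trans _ _ (expR (- log_term R p s))).
      by rewrite ler_expR; nra.
    rewrite expR_log_term// (_ : s%:R / _ = s%:R / p%:R / (9 * expR 1));
      last first.
      by field; rewrite !gt_eqF ?expR_gt0.
    apply: ler_wpM2l; first by rewrite divr_ge0.
    rewrite lef_pV2 ?posrE ?mulr_gt0 ?expR_gt0//.
    by have := expR1_ge2 R; lra.
  have H2 : 4 * tau ^+ 2 / (1 + M) ^+ 2 <= tau ^+ 2.
    rewrite ler_pdivrMr; last by rewrite exprn_gt0//; lra.
    by rewrite mulrC ler_wpM2l ?sqr_ge0//; nra.
  rewrite -[leRHS]mulrA; apply: ler_pM => //; rewrite ?expR_ge0//.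
  by rewrite divr_ge0 ?sqr_ge0// mulr_ge0// sqr_ge0.
under eq_integral do rewrite excessE -sumEFin.
rewrite ge0_integral_sum//; last 2 first.
- by move=> j; exact/measurable_EFinP.
- by move=> j w _; rewrite lee_fin.
apply: (@le_trans _ _ (\sum_j (bnd j)%:E)%E); first by apply: lee_sum => j _;
  exact: IG.
rewrite sumEFin lee_fin (bigID S)/=.
rewrite (eq_bigr (fun=> 8 / 7 * tau ^+ 2)); last by move=> j;
  rewrite /bnd => ->.
rewrite sumr_const.
have -> : \sum_(j | ~~ S j) bnd j =
  \sum_(j | ~~ S j) tau ^+ 2 * (s%:R / p%:R) / 18.
  by apply: eq_bigr => j; rewrite /bnd => /negbTE ->.
have H : \sum_(j | ~~ S j) tau ^+ 2 * (s%:R / p%:R) / 18 <=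
  tau ^+ 2 * s%:R / 18.
  rewrite sumr_const -[leLHS]mulr_natr.
  have : (#|[pred j | ~~ S j]|)%:R <= p%:R :> R.
    by rewrite ler_nat -[p in (_ <= p)%N]card_ord max_card.
  set q := (#|_|)%:R => qp.
  have -> : tau ^+ 2 * s%:R / 18 = tau ^+ 2 * (s%:R / p%:R) / 18 * p%:R.
    by field; rewrite gt_eqF.
  by rewrite ler_wpM2l// divr_ge0// mulr_ge0 ?sqr_ge0// divr_ge0// ltW.
rewrite cardS -[_ *+ s]mulr_natr.
have t2 : 0 < tau ^+ 2 * s%:R by rewrite mulr_gt0// exprn_gt0.
apply: (le_trans (lerD (lexx _) H)); lra.
Qed.

End NoiseEvent.

(** * Bounds on the noise event *)

Lemma l1norm_support (R : realType) (p : nat) (b : 'cV[R]_p) (S : pred 'I_p) :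
  \sum_(j | S j) `|b j 0| <= Num.sqrt (#|S|)%:R * l2norm b.
Proof.
have -> : (#|S|)%:R = \sum_j (S j)%:R ^+ 2 :> R.
  rewrite -sum1_card natr_sum big_mkcond; apply: eq_bigr => j _.
  by rewrite unfold_in; case: (S j); rewrite ?expr1n ?expr0n.
have -> : l2norm b = Num.sqrt (\sum_i `|b i 0| ^+ 2).
  by congr Num.sqrt; apply: eq_bigr => i _; rewrite real_normK ?num_real.
apply: le_trans (cauchy_schwarz_sum _ _).
rewrite big_mkcond; apply: ler_sum => j _.
by case: (S j); rewrite ?mul1r ?mul0r.
Qed.

Section Deterministic.
Variables (R : realType) (n p : nat) (X : 'M[R]_(n, p)) (bs : 'cV[R]_p).
Variables (s : nat) (sigma lambda gamma : R).
Hypotheses (n_gt0 : (0 < n)%N) (sE : s = l0norm bs) (s_gt0 : (0 < s)%N).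
Hypotheses (sigma_gt0 : 0 < sigma) (gamma_gt0 : 0 < gamma).
Hypothesis lambda_ge : sigma * (1 + gamma) * (1 + delta X s) *
  (1 + Num.sqrt (2 * log_term R p s)) <= lambda.

Let supp : pred 'I_p := fun j => bs j 0 != 0.
Definition noise_level := sigma * (1 + delta X s).
Definition threshold := lambda / (1 + gamma).

Let card_supp : #|supp| = s. Proof. by rewrite sE. Qed.

Let s_le_p : (s <= p)%N.
Proof. by rewrite -card_supp -[p in (_ <= p)%N]card_ord max_card. Qed.

Lemma noise_level_gt0 : 0 < noise_level.
Proof. by rewrite mulr_gt0// ltr_pwDl// delta_ge0. Qed.

Lemma noise_level_threshold :
  noise_level * (1 + Num.sqrt (2 * log_term R p s)) <= threshold.
Proof.
rewrite ler_pdivlMr; last by rewrite ltr_pwDl// ltW.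
by apply: le_trans lambda_ge; rewrite /noise_level; lra.
Qed.

Let log_ge1 : 1 <= log_term R p s. Proof. exact: log_term_ge1. Qed.

Lemma threshold_gt0 : 0 < threshold.
Proof.
by apply: lt_le_trans noise_level_threshold; rewrite mulr_gt0 ?noise_level_gt0.
Qed.

Let lambdaE : lambda = (1 + gamma) * threshold.
Proof. by rewrite /threshold; field; rewrite gt_eqF// ltr_pwDl// ltW. Qed.

Lemma lambda_gt0 : 0 < lambda.
Proof. by rewrite lambdaE mulr_gt0 ?threshold_gt0// ltr_pwDl// ltW. Qed.

(* The slack threshold / noise_level >= sqrt (2 log_term) is spent twice: on the
   sqrt 3 of cone_const, and on the sqrt 3 / sqrt log_term of Cbar. *)
Lemma sqrt6_noise_level_le :
  Num.sqrt 6 * noise_level <=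
  Num.sqrt 3 * threshold / Num.sqrt (log_term R p s).
Proof.
have l0 : 0 < Num.sqrt (log_term R p s) by rewrite sqrtr_gt0 (lt_le_trans
  ltr01).
rewrite ler_pdivlMr//.
have -> : 6 = 3 * 2 :> R by ring.
have t0 := noise_level_gt0; have := noise_level_threshold;
  move: noise_level t0 => t t0 tl.
rewrite sqrtrM// -!mulrA ler_wpM2l ?sqrtr_ge0//.
by apply: le_trans tl; rewrite sqrtrM//; lra.
Qed.

Lemma sqrt6_noise_level_le_threshold : Num.sqrt 6 * noise_level <=
  Num.sqrt 3 * threshold.
Proof.
apply: (le_trans sqrt6_noise_level_le);
  have l1 : 1 <= Num.sqrt (log_term R p s).
  by rewrite -[leLHS]sqrtr1 ler_wsqrtr.
rewrite ler_pdivrMr; last exact: lt_le_trans l1.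
by rewrite ler_peMr// mulr_ge0 ?sqrtr_ge0// ltW// threshold_gt0.
Qed.

(** A standard basis vector is 1-sparse and [s >= 1], so [delta] controls every column of [X]; this
    bounds the variance of a score coordinate. *)
Lemma column_norm_le (j : 'I_p) :
  sigma ^+ 2 * \sum_i (X i j / Num.sqrt n%:R) ^+ 2 <= noise_level ^+ 2.
Proof.
have n0 : 0 < Num.sqrt n%:R :> R by rewrite sqrtr_gt0 ltr0n.
have dj : (l0norm (delta_mx j 0%R : 'cV[R]_p) <= s)%N.
  apply: leq_trans s_gt0; rewrite /l0norm -[X in (_ <= X)%N](card1 j);
    apply: subset_leq_card.
  apply/fintype.subsetP => i; rewrite !inE mxE eqxx andbT.
  by case: (i == j) => //=; rewrite mulr0n eqxx.
have := l2norm_mulmx_delta X n_gt0 dj.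
have -> : l2norm (delta_mx j 0 : 'cV[R]_p) = 1.
  rewrite /l2norm (bigD1 j)//= big1 => [|i ij].
    by rewrite addr0 mxE !eqxx expr1n sqrtr1.
  by rewrite mxE (negbTE ij) expr0n.
rewrite mulr1 => H.
have -> : \sum_i (X i j / Num.sqrt n%:R) ^+ 2 =
    (l2norm (X *m delta_mx j 0) / Num.sqrt n%:R) ^+ 2.
  rewrite expr_div_n l2norm_sqr mulr_suml; apply: eq_bigr => i _.
  by rewrite -colE mxE -expr2 expr_div_n.
rewrite /noise_level (exprMn _ sigma) ler_wpM2l ?sqr_ge0// ler_pXn2r ?nnegrE//.
- by rewrite ler_pdivrMr// mulrC.
- by rewrite divr_ge0 ?l2norm_ge0 ?ltW.
- by rewrite addr_ge0// delta_ge0.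
Qed.

Definition sign_vector : 'cV[R]_p := \col_j Num.sg (bs j 0).

Lemma l2norm_sign_vector : l2norm sign_vector = Num.sqrt s%:R.
Proof.
rewrite /l2norm; congr Num.sqrt;
  rewrite -card_supp -sum1_card natr_sum [RHS]big_mkcond.
apply: eq_bigr => j _; rewrite mxE unfold_in /supp sqr_sg.
by case: eqP.
Qed.

Lemma design_sign_vector_le :
  l2norm (X *m sign_vector) <= Num.sqrt n%:R * (1 + delta X s) * Num.sqrt s%:R.
Proof.
rewrite -l2norm_sign_vector; apply: l2norm_mulmx_delta => //.
rewrite sE /l0norm; apply: subset_leq_card; apply/fintype.subsetP => j.
by rewrite !inE mxE sgr_eq0.
Qed.

(** The step does not carry a support coordinate past zero, so each of the [s] moduli changes by
    exactly [- t]. *)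
Lemma h_shrink t : (forall j, bs j 0 != 0 -> t <= `|bs j 0|) ->
  h n lambda (bs - t *: sign_vector) =
  h n lambda bs - Num.sqrt n%:R * lambda * t * s%:R.
Proof.
move=> tb; rewrite /h.
transitivity (Num.sqrt n%:R * lambda * (l1norm bs - t * s%:R)); last by ring.
congr (_ * _).
have -> : t * s%:R = \sum_j if supp j then t else 0.
  by rewrite -big_mkcond sumr_const card_supp mulr_natr.
rewrite -sumrB; apply: eq_bigr => j _; rewrite !mxE /supp.
have [b0|b0] /= := eqVneq (bs j 0) 0.
  by rewrite b0 sgr0 mulr0 subr0 normr0 subr0.
have H : bs j 0 - t * Num.sg (bs j 0) = Num.sg (bs j 0) * (`|bs j 0| - t).
  by rewrite mulrBr -numEsg mulrC.
by rewrite H normrM normr_sg b0 mul1r ger0_norm// subr_ge0 tb.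
Qed.

Section Fit.
Variables (e : 'cV[R]_n) (bh : 'cV[R]_p).
Hypothesis bh_min : argmin (lasso_objective X lambda (X *m bs + e)) bh.

Let u := bh - bs.

Definition score : 'cV[R]_p := (Num.sqrt n%:R)^-1 *: (X^T *m e).

Let n0 : 0 < Num.sqrt n%:R :> R. Proof. by rewrite sqrtr_gt0 ltr0n. Qed.

Let residual : X *m bh - (X *m bs + e) = X *m u - e.
Proof. by rewrite /u mulmxBr opprD addrA. Qed.

Lemma fit_sqr_le : l2norm (X *m u) ^+ 2 <=
  cdot e (X *m u) + h n lambda bs - h n lambda bh.
Proof.
have := lasso_variational (ltW lambda_gt0) bs bh_min.
rewrite residual -(opprB bh) -/u mulmxN cdotNr cdotDl cdotNl l2norm_sqr.
lra.
Qed.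

Hypothesis score_small : \sum_(j | supp j) score j 0 ^+ 2 +
  \sum_(j | ~~ supp j) Num.max (`|score j 0| - threshold) 0 ^+ 2 <=
  6 * s%:R * noise_level ^+ 2.

(** Per unit of off-support l1 mass the noise costs [threshold] and the penalty returns [lambda],
    which leaves [lambda - threshold = gamma * threshold]. *)
Lemma gap_le : cdot e (X *m u) + h n lambda bs - h n lambda bh <=
  Num.sqrt n%:R *
    (Num.sqrt s%:R * (lambda + Num.sqrt 6 * noise_level) * l2norm u -
     gamma * threshold * \sum_(j | ~~ supp j) `|u j 0|).
Proof.
set tail := \sum_(j | ~~ _) _.
have H1 : cdot e (X *m u) <= Num.sqrt n%:R *
    (Num.sqrt 6 * Num.sqrt s%:R * noise_level * l2norm u + threshold * tail).
  have -> : cdot e (X *m u) = Num.sqrt n%:R * cdot score u.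
    by rewrite (cdotC score) cdotZr cdot_mulmx (cdotC u) mulrA mulfV ?mul1r//
      gt_eqF.
  apply: ler_wpM2l; first exact: ltW.
  apply: (le_trans (noise_bound _ _ supp (ltW threshold_gt0))).
  rewrite lerD2r ler_wpM2r ?l2norm_ge0//.
  apply: (le_trans (ler_wsqrtr score_small)).
  rewrite sqrtrM ?mulr_ge0// sqrtrM// sqrtr_sqr ger0_norm// ltW//.
  exact: noise_level_gt0.
(* On the support this is the triangle inequality; off it [bh] and [u] coincide. *)
have H2 : h n lambda bs - h n lambda bh <=
    Num.sqrt n%:R * (lambda * (Num.sqrt s%:R * l2norm u - tail)).
  rewrite /h -mulrBr -mulrA; apply: ler_wpM2l; first exact: ltW.
  apply: ler_wpM2l; first exact: (ltW lambda_gt0).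
  have := l1norm_support u supp; rewrite card_supp => H.
  apply: le_trans (lerD H (lexx _)).
  rewrite /l1norm (bigID supp)/= [X in _ - X <= _](bigID supp)/=.
  have -> : \sum_(j | ~~ supp j) `|bs j 0| = 0.
    by apply: big1 => j; rewrite /supp negbK => /eqP ->; rewrite normr0.
  have -> : \sum_(j | ~~ supp j) `|bh j 0| = tail.
    apply: eq_bigr => j; rewrite /supp negbK => /eqP bj.
    by rewrite !mxE bj subr0.
  rewrite addr0 opprD addrA lerD2r -sumrB; apply: ler_sum => j _.
  rewrite !mxE lerBlDr; have := ler_normD (bs j 0 - bh j 0) (bh j 0).
  by rewrite subrK distrC.
rewrite -addrA; apply: (le_trans (lerD H1 H2)); rewrite -mulrDr.
apply: ler_wpM2l; first exact: ltW.
have -> : gamma * threshold = lambda - threshold by rewrite lambdaE; ring.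
lra.
Qed.

Hypothesis kappa_neq0 : kappa X (cone_const gamma) s != 0.

(** The gap dominates a square, so [gap_le] bounds the off-support mass of [u]. As [lambda] is
    [(1 + gamma) * threshold], dividing by [gamma * threshold] produces [cone_const gamma]. *)
Lemma kappa_fit_le :
  kappa X (cone_const gamma) s * (Num.sqrt n%:R * l2norm u) <= l2norm (X *m u).
Proof.
(* The zero vector lies outside [RE_cone], but for it both sides vanish. *)
have [u0|u0] := eqVneq u 0.
  have -> : l2norm u = 0 by rewrite u0 -(scale0r 0) l2normZ normr0 mul0r.
  by rewrite !mulr0 l2norm_ge0.
apply: kappa_le => //; split => //.
apply: (le_trans (rearrangement_tail _ s_gt0 card_supp)).
have := le_trans (le_trans (sqr_ge0 _) fit_sqr_le) gap_le.
rewrite pmulr_rge0// subr_ge0 => H.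
have gl : 0 < gamma * threshold by rewrite mulr_gt0// threshold_gt0.
rewrite -(ler_pM2l gl); apply: (le_trans H).
rewrite /cone_const.
rewrite (_ : gamma * _ * _ =
  Num.sqrt s%:R * (lambda + Num.sqrt 3 * threshold) * l2norm u); last first.
  by rewrite lambdaE; field; rewrite gt_eqF.
rewrite ler_wpM2r ?l2norm_ge0// ler_wpM2l ?sqrtr_ge0// lerD2l.
exact: sqrt6_noise_level_le_threshold.
Qed.

Lemma Cbar_fin : Cbar X sigma lambda gamma s =
  (fine (Cbar X sigma lambda gamma s))%:E.
Proof. by rewrite /Cbar (negbTE kappa_neq0). Qed.

(** The negative tail is dropped, the noise term is absorbed as [lambda * eta], and [kappa_fit_le]
    exchanges [l2norm u] for the fit. Being linear in the fit, the bound serves both the upper and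
    the lower estimate. *)
Lemma gap_le_Cbar : cdot e (X *m u) + h n lambda bs - h n lambda bh <=
  fine (Cbar X sigma lambda gamma s) * (lambda * Num.sqrt s%:R) *
  l2norm (X *m u).
Proof.
apply: (le_trans gap_le).
have k0 : 0 < kappa X (cone_const gamma) s by rewrite lt_neqAle eq_sym
  kappa_neq0 kappa_ge0.
have l0 : 0 < Num.sqrt (log_term R p s) by rewrite sqrtr_gt0 (lt_le_trans
  ltr01).
have s0 : 0 < Num.sqrt s%:R :> R by rewrite sqrtr_gt0 ltr0n.
rewrite /Cbar (negbTE kappa_neq0) /=.
have kfit := kappa_fit_le.
set k := kappa _ _ _ in k0 kfit *; set eta := Num.sqrt 3 / _.
set q := sigma * k * _ / _.
have q0 : 0 <= q.
  rewrite divr_ge0 ?mulr_ge0 ?addr_ge0 ?mulr_ge0 ?sqrtr_ge0 ?(ltW sigma_gt0)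
    ?(ltW k0)//.
  exact: ltW lambda_gt0.
apply: (@le_trans _ _ (Num.sqrt s%:R * (lambda * (1 + eta)) * (Num.sqrt n%:R *
  l2norm u))).
  rewrite [leRHS]mulrCA; apply: ler_wpM2l; first exact: ltW.
  apply: (@le_trans _ _ (Num.sqrt s%:R * (lambda + Num.sqrt 6 * noise_level) *
    l2norm u)).
    rewrite gerBl; apply: mulr_ge0; last exact: sumr_ge0.
    by rewrite mulr_ge0 ?(ltW gamma_gt0) ?(ltW threshold_gt0).
  rewrite ler_wpM2r ?l2norm_ge0// ler_wpM2l ?sqrtr_ge0// mulrDr mulr1 lerD2l.
  apply: (le_trans sqrt6_noise_level_le).
  rewrite (_ : _ / _ = threshold * eta); last by rewrite /eta; ring.
  apply: ler_wpM2r; first by rewrite divr_ge0 ?sqrtr_ge0.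
  by rewrite lambdaE ler_peMl ?(ltW threshold_gt0)// lerDl ltW.
apply: (@le_trans _ _ (Num.sqrt s%:R * (lambda * (1 + eta)) * (l2norm (X *m u)
  / k))).
  apply: ler_wpM2l; last by rewrite ler_pdivlMr// mulrC.
  rewrite !mulr_ge0 ?sqrtr_ge0 ?(ltW lambda_gt0)// addr_ge0// divr_ge0
    ?sqrtr_ge0//.
rewrite (_ : _ * (_ / k) =
  (1 / k * (1 + eta)) * (lambda * Num.sqrt s%:R) * l2norm (X *m u)); last first.
  by field; rewrite gt_eqF.
rewrite ler_wpM2r ?l2norm_ge0// ler_wpM2r//.
  by rewrite mulr_ge0 ?sqrtr_ge0// ltW// lambda_gt0.
rewrite ler_wpM2l ?divr_ge0 ?(ltW k0)//; lra.
Qed.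

Lemma fit_upper_bound : l2norm (X *m u) <=
  fine (Cbar X sigma lambda gamma s) * (lambda * Num.sqrt s%:R).
Proof.
have := le_trans fit_sqr_le gap_le_Cbar; have a0 := l2norm_ge0 (X *m u).
(* A zero fit cannot be divided out; the claim is then that the bound is nonnegative. *)
have [->|an] := eqVneq (l2norm (X *m u)) 0.
  rewrite /Cbar (negbTE kappa_neq0) /= => _.
  have l0 := ltW lambda_gt0; have sg0 := ltW sigma_gt0.
  have k0 := kappa_ge0 X (cone_const gamma) s.
  by rewrite !(mulr_ge0, addr_ge0, invr_ge0, sqrtr_ge0).
by rewrite expr2 ler_pM2r// lt_neqAle eq_sym an.
Qed.

Hypothesis Cbar_le : fine (Cbar X sigma lambda gamma s) <= 2 * Clow X s.
Hypothesis large_signal : forall j, bs j 0 != 0 ->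
  (2 * Clow X s - fine (Cbar X sigma lambda gamma s)) * Clow X s * lambda /
    Num.sqrt n%:R <= `|bs j 0|.

Lemma fit_lower_bound : cdot e (X *m sign_vector) <= 0 ->
  lambda * Num.sqrt s%:R * Clow X s *
    (1 - Num.sqrt (fine (Cbar X sigma lambda gamma s) / Clow X s - 1)) <=
  l2norm (X *m u).
Proof.
move=> ew; move: gap_le_Cbar Cbar_le large_signal.
set Cb := fine _; set a := l2norm (X *m u) => gapB CbC large.
set t := (2 * Clow X s - Cb) * Clow X s * lambda / Num.sqrt n%:R in large.
set C := Clow X s in CbC t large *.
have d0 : 0 < 1 + delta X s by rewrite ltr_pwDl// delta_ge0.
have C0 : 0 < C by rewrite divr_gt0.
have s0 : 0 < Num.sqrt s%:R :> R by rewrite sqrtr_gt0 ltr0n.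
have t0 : 0 <= t.
  apply: divr_ge0; last exact: ltW.
  apply: mulr_ge0; last exact: (ltW lambda_gt0).
  by apply: mulr_ge0; [rewrite subr_ge0|exact: ltW].
have a0 : 0 <= a by exact: l2norm_ge0.
pose A := lambda * Num.sqrt s%:R * C.
have A0 : 0 < A by rewrite /A; apply: mulr_gt0 => //; apply: mulr_gt0 => //;
  exact: lambda_gt0.
(* The factor [1 + delta X s] cancels against the [Clow X s] in [t]. *)
have tX : t * l2norm (X *m sign_vector) <=
  (2 * C - Cb) * (lambda * Num.sqrt s%:R).
  apply: (le_trans (ler_wpM2l t0 design_sign_vector_le)).
  rewrite le_eqVlt; apply/orP; left; apply/eqP; rewrite /t /C /Clow; field.
  by rewrite !gt_eqF.
have tn : Num.sqrt n%:R * lambda * t * s%:R =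
    (2 * C - Cb) * (lambda * Num.sqrt s%:R) * A.
  rewrite -[in LHS](@sqr_sqrtr _ s%:R)// /t /A; field.
  by rewrite gt_eqF.
have := lasso_variational (ltW lambda_gt0) (bs - t *: sign_vector) bh_min.
rewrite h_shrink// tn residual.
have -> : bs - t *: sign_vector - bh =
  - u - t *: sign_vector by rewrite /u opprB addrAC.
rewrite (mulmxBr X (- u)) -scalemxAr mulmxN cdotDr !cdotNr cdotZr !cdotDl
  !cdotNl -l2norm_sqr -/a.
have cs : - (t * (l2norm (X *m sign_vector) * a)) <=
  t * cdot (X *m u) (X *m sign_vector).
  by rewrite -mulrN ler_wpM2l// mulrC cdot_ge.
have ca := ler_wpM2r a0 tX.
have te : t * cdot e (X *m sign_vector) <= 0 by rewrite mulr_ge0_le0.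
set q := (2 * C - Cb) * (lambda * Num.sqrt s%:R) in ca *.
have qA : q = 2 * A - Cb * (lambda * Num.sqrt s%:R) by rewrite /q /A; ring.
rewrite mulrDr mulrN => kkt.
(* With [B = Cb * (lambda * Num.sqrt s%:R)] and [q = 2 * A - B], the linear terms [q * a] and
   [B * a] add up to [2 * A * a]: the size of [t] is chosen to complete this square. *)
have main : (A - a) ^+ 2 <= A ^+ 2 * (Cb / C - 1).
  have -> : A ^+ 2 * (Cb / C - 1) = A * (Cb * (lambda * Num.sqrt s%:R) - A).
    by rewrite /A; field; rewrite gt_eqF.
  move: gapB ca; rewrite qA mulrA; nra.
have := ler_wsqrtr main;
  rewrite (sqrtrM _ (sqr_ge0 A)) !sqrtr_sqr (gtr0_norm A0) => H.
have := le_trans (ler_norm _) H; rewrite -/A; lra.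
Qed.

End Fit.
End Deterministic.

(** * Intersecting the events and proof of the two probability bounds *)

Lemma probability_setI_ge (d : measure_display) (T : measurableType d)
    (R : realType) (P : probability T R) (A B : set T) (a b : R) :
  measurable A -> measurable B -> (a%:E <= P A)%E -> (b%:E <= P B)%E ->
  ((a + b - 1)%:E <= P (A `&` B))%E.
Proof.
move=> mA mB aA bB.
(* [B] is covered by its intersection with [A] and the complement of [A]. *)
have : (P B <= P (A `&` B) + P (~` A))%E.
  have mAB : measurable (A `&` B) by exact: measurableI.
  have mCA : measurable (~` A) by exact: measurableC.
  apply: le_trans (measureU2 _ mAB mCA).
  apply: le_measure; rewrite ?inE//; first exact: measurableU.
  by move=> x Bx; have [Ax|nAx] := pselect (A x); [left|right].
rewrite probability_setC//.
have fP C : measurable C -> P C \is a fin_num by exact: fin_num_measure.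
have mAB : measurable (A `&` B) by exact: measurableI.
move: aA bB; case: (P A) (fP _ mA) => // x _; case: (P B) (fP _ mB) => // z _.
case: (P (A `&` B)) (fP _ mAB) => // t _.
rewrite -EFinB -EFinD !lee_fin; lra.
Qed.

(* Every minimizer has the same X *m betahat w, which is a Lipschitz function
   of the noise vector, so the two events are measurable for any selection
   betahat of minimizers. *)
Theorem theorem4p2 (R : realType) (d : measure_display) (T : measurableType d)
    (P : probability T R) (n p : nat) (X : 'M[R]_(n, p)) (betastar : 'cV[R]_p)
    (s : nat) (sigma lambda gamma : R) (eps : 'I_n -> {RV P >-> R})
    (y : T -> 'cV[R]_n) (betahat : T -> 'cV[R]_p) :
  (0 < n)%N ->
  s = l0norm betastar -> (1 <= s)%N ->
  0 < sigma -> isotropic_gaussian sigma eps ->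
  (forall w, y w = X *m betastar + rv_vector eps w) ->
  (forall w, argmin (lasso_objective X lambda (y w)) (betahat w)) ->
  0 < gamma ->
  sigma * (1 + gamma) * (1 + delta X s) * (1 + Num.sqrt (2 * log_term R p s))
    <= lambda ->
  ((76 / 100)%:E <= P [set w |
     ((l2norm (X *m (betahat w - betastar)))%:E <=
        Cbar X sigma lambda gamma s * (lambda * Num.sqrt s%:R)%:E)%E])%E /\
  ((Cbar X sigma lambda gamma s <= (2 * Clow X s)%:E)%E ->
   (forall j, betastar j 0 != 0 ->
      (2 * Clow X s - fine (Cbar X sigma lambda gamma s)) * Clow X s * lambda
        / Num.sqrt n%:R <= `|betastar j 0|) ->
   ((26 / 100)%:E <= P [set w |
      (lambda * Num.sqrt s%:R * Clow X s *
        (1 - Num.sqrt (fine (Cbar X sigma lambda gamma s) / Clow X s - 1))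
      <= l2norm (X *m (betahat w - betastar)))%R])%E).
Proof.
move=> n0 sE s0 sig0 gauss yE bmin gam0 lam.
pose S : pred 'I_p := fun j => betastar j 0 != 0.
have cS : #|S| = s by rewrite sE.
have lam0 := lambda_gt0 sig0 gam0 lam.
have bmin' w :
    argmin (lasso_objective X lambda (X *m betastar + rv_vector eps w))
      (betahat w) by rewrite -yE.
pose fit w := l2norm (X *m (betahat w - betastar)).
have mfit : measurable_fun setT fit.
  apply: (@lipschitz_measurable _ _ _ n (fun i => eps i)) => [i|w w'].
    exact: measurable_funPT.
  have -> : \sum_i `|eps i w - eps i w'| =
      \sum_i `|(rv_vector eps w - rv_vector eps w') i 0|.
    by apply: eq_bigr => i _; rewrite !mxE.
  apply: le_trans (l2norm_le_sum _).
  have -> : rv_vector eps w - rv_vector eps w' = y w - y w'.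
    by rewrite !yE opprD addrACA subrr add0r.
  apply: le_trans (lasso_fit_lipschitz (ltW lam0) (bmin w) (bmin w')).
  rewrite lerBlDr /fit; apply: le_trans (l2normD _ _).
  by rewrite -mulmxDr addrA subrK.
have mfit_set (A : set R) : measurable A -> measurable (fit @^-1` A).
  by move=> mA; rewrite -[X in measurable X]setTI; exact: mfit.
pose a (j : 'I_p) (i : 'I_n) := X i j / Num.sqrt n%:R.
pose good := [set w | excess eps a S (threshold lambda gamma) w <=
  6 * s%:R * noise_level X s sigma ^+ 2].
have Pgood : ((76 / 100)%:E <= P good)%E.
  apply: (excess_prob sig0 gauss _ _ cS s0).
  - exact: noise_level_gt0.
  - by move=> j; exact: (column_norm_le X sigma n0 s0).
  - exact: (noise_level_threshold gam0 lam).
have mgood : measurable good.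
  rewrite (_ : good = setT `&` excess eps a S (threshold lambda gamma) @^-1`
      `]-oo, (6 * s%:R * noise_level X s sigma ^+ 2)]).
    exact: measurable_excess.
  by rewrite setTI; apply/seteqP; split => w /=; rewrite in_itv.
have scoreE w j : score X (rv_vector eps w) j 0 = \sum_i a j i * eps i w.
  rewrite /score !mxE mulr_sumr; apply: eq_bigr => i _.
  by rewrite !mxE /a mulrCA mulrA.
have good_score w : good w ->
    \sum_(j | S j) score X (rv_vector eps w) j 0 ^+ 2 +
    \sum_(j | ~~ S j)
      Num.max (`|score X (rv_vector eps w) j 0| - threshold lambda gamma) 0
        ^+ 2 <=
    6 * s%:R * noise_level X s sigma ^+ 2.
  rewrite /good /excess /= => gw.
  under eq_bigr do rewrite scoreE.
  by under [X in _ + X]eq_bigr do rewrite scoreE.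
(* For a zero [kappa], [Cbar] is [+oo]: the upper bound holds everywhere and the premise of the
   lower bound is false. *)
have [k0|k0] := eqVneq (kappa X (cone_const gamma) s) 0.
  rewrite {2}/Cbar k0 eqxx; split => //.
  rewrite (_ : [set w | _] = setT); first by rewrite probability_setT lee_fin;
    lra.
  apply/seteqP; split => // w _ /=; rewrite /Cbar k0 eqxx gt0_mulye ?leey//.
  by rewrite lte_fin mulr_gt0// sqrtr_gt0 ltr0n.
split.
  apply: (le_trans Pgood); rewrite Cbar_fin//.
  apply: le_measure; rewrite ?inE//.
    rewrite (_ : [set w | _] = fit @^-1` `]-oo,
        (fine (Cbar X sigma lambda gamma s) * (lambda * Num.sqrt s%:R))]).
      exact: mfit_set.
    by apply/seteqP; split => w /=; rewrite -EFinM lee_fin in_itv.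
  move=> w gw /=; rewrite -EFinM lee_fin.
  by apply: (fit_upper_bound n0 sE s0 sig0 gam0 lam (bmin' w)) => //;
    exact: good_score.
rewrite {1}Cbar_fin// lee_fin => CbC large.
pose v i := (X *m sign_vector betastar) i 0.
have vE w : \sum_i v i * eps i w =
  cdot (rv_vector eps w) (X *m sign_vector betastar).
  by rewrite cdotC; apply: eq_bigr => i _; congr (_ * _); rewrite mxE.
have mv : measurable [set w | \sum_i v i * eps i w <= 0].
  rewrite (_ : [set w | _] =
    setT `&` (fun w => \sum_i v i * eps i w) @^-1` `]-oo, 0]).
    by apply: (@measurable_sum _ _ _ setT) => // i;
      apply: measurable_funM => //; exact: measurable_funPT.
  by rewrite setTI; apply/seteqP; split => w /=; rewrite in_itv.
(* The two events may be dependent; the count is [0.76 + 0.5 - 1 = 0.26]. *)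
have := probability_setI_ge mgood mv Pgood (gaussian_linear_half sig0 gauss v).
rewrite (_ : 76 / 100 + 2^-1 - 1 = 26 / 100); last by field.
move=> H; apply: (le_trans H); apply: le_measure; rewrite ?inE//.
- exact: measurableI.
- rewrite (_ : [set w | _] = fit @^-1` `[lambda * Num.sqrt s%:R * Clow X s *
      (1 - Num.sqrt (fine (Cbar X sigma lambda gamma s) / Clow X s - 1)), +oo[).
    exact: mfit_set.
  by apply/seteqP; split => w /=; rewrite in_itv/= andbT.
move=> w [gw]; rewrite /= vE => vw.
by apply: (fit_lower_bound n0 sE s0 sig0 gam0 lam (bmin' w)) => //;
  exact: good_score.
Qed.
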